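(* Let $\Delta$ be the clique complex of a chordal graph with at least two maximal cliques, with facets $S_1,\ldots,S_e$ in a fixed leaf order, separator cardinalities $r_1,\ldots,r_{e-1}$, $r_{\min}=\min_m r_m$, $n_{\min}=\min_m|S_m|$, and $d=\dim\Delta$. For every $-1\le k\le d$, the following statements hold. (i) The ring $\mathbb K[\Delta_{(k)}]$ is initially Cohen–Macaulay if and only if $$k\le r_{\min}\qquad\text{or}\qquad r_{\min}=n_{\min}-1.$$ Thus, if $r_{\min}<n_{\min}-1$, the initially Cohen–Macaulay skeletons are exactly those with $k\le r_{\min}$; if $r_{\min}=n_{\min}-1$, every skeleton is initially Cohen–Macaulay. (ii) The ring $\mathbb K[\Delta_{(k)}]$ is Cohen–Macaulay if and only if $k\le r_{\min}$.
   Context: $\mathbb K$ is a field. For a finite set $X$, put $R=\mathbb K[x:x\in X]$ with the standard grading. A simplicial complex $\Sigma$ on $X$ is a collection of subsets (faces) of $X$ closed under inclusion; elements of $X$ not lying in any face (ghost vertices) are allowed. Facets are the maximal faces, a face $F$ has dimension $|F|-1$, and $\dim\Sigma$ is the largest dimension of a face. The $k$-skeleton $\Sigma_{(k)}$ consists of all faces of dimension at most $k$, viewed as a complex on the same set $X$; $\Sigma_{(-1)}=\{\varnothing\}$. $I_\Sigma\subseteq R$ is generated by the monomials $\prod_{x\in A}x$ with $A\subseteq X$, $A\notin\Sigma$; $\mathbb K[\Sigma]=R/I_\Sigma$. For a finitely generated graded $R$-module $M$, its initial dimension is $\operatorname{indim}M=\min\{\dim R/P:P\in\operatorname{Ass}_R(M)\}$,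 and $M$ is initially Cohen–Macaulay if $\operatorname{depth}M=\operatorname{indim}M$. (For $\mathbb K[\Sigma]$ the initial dimension is the smallest cardinality of a facet of $\Sigma$.) Chordal clique complexes: let $\Delta$ be the complex of cliques of a finite chordal graph with vertex set $X$, having $e\ge2$ maximal cliques. A leaf order of its facets (maximal cliques) is an ordering $S_1,\ldots,S_e$ such that for each $m\ge2$ there is $p(m)<m$ satisfying $S_m\cap S_i\subseteq S_m\cap S_{p(m)}$ for all $i<m$; such an order exists. For $1\le m\le e-1$ the separators are $Q_m=(S_1\cup\cdots\cup S_m)\cap S_{m+1}=S_{p(m+1)}\cap S_{m+1}$ (possibly empty), and $r_m=|Q_m|$. *)

(* Defs.v *)
From HB Require Import structures.
From mathcomp Require Import all_boot all_order all_algebra.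
From mathcomp Require Export mpoly.
From mathcomp Require Export boolp.

Set Implicit Arguments.
Unset Strict Implicit.
Unset Printing Implicit Defensive.

Import GRing.Theory.
Local Open Scope ring_scope.
Local Open Scope quotient_scope.

Section Generated.
Variables (R : comNzRingType) (T : finType) (P : pred T) (g : T -> R).

Definition ideal_gen : {pred R} :=
  fun f => `[< exists c : T -> R, f = \sum_(i | P i) c i * g i >].

Lemma ideal_gen_zmod : zmod_closed ideal_gen.
Proof.
split=> [|x y /asboolP[c ->] /asboolP[d ->]]; apply/asboolP.
  by exists (fun=> 0); rewrite big1 // => i _; rewrite mul0r.
exists (fun i => c i - d i); rewrite -sumrB.
by apply: eq_bigr => i _; rewrite mulrBl.
Qed.

Lemma ideal_genM a u : u \in ideal_gen -> a * u \in ideal_gen.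
Proof.
move=> /asboolP[c ->]; apply/asboolP; exists (fun i => a * c i).
by rewrite mulr_sumr; apply: eq_bigr => i _; rewrite mulrA.
Qed.

HB.instance Definition _ := GRing.isZmodClosed.Build R ideal_gen ideal_gen_zmod.

(* The quotient is only made an R-module: no properness of the ideal, hence no
   nontriviality of the quotient ring, is required. *)
Definition quot_gen : Type := {ideal_quot ideal_gen}.
HB.instance Definition _ := GRing.Zmodule.on quot_gen.

Definition quot_scale (a : R) (x : quot_gen) : quot_gen :=
  \pi_({ideal_quot ideal_gen}) (a * repr (x : {ideal_quot ideal_gen})).

Lemma quot_scale_pi a f :
  quot_scale a (\pi_({ideal_quot ideal_gen}) f) = \pi_({ideal_quot ideal_gen}) (a * f).
Proof.
apply/eqP; rewrite /quot_scale -Quotient.idealrBE -mulrBr.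
by apply: ideal_genM; rewrite Quotient.idealrBE reprK.
Qed.

Lemma quot_genP (x : quot_gen) : exists f, x = \pi_({ideal_quot ideal_gen}) f.
Proof. by exists (repr (x : {ideal_quot ideal_gen})); rewrite reprK. Qed.

Lemma quot_genD f h : \pi_({ideal_quot ideal_gen}) (f + h) =
  (\pi_({ideal_quot ideal_gen}) f : quot_gen) + \pi_({ideal_quot ideal_gen}) h.
Proof. by rewrite -raddfD. Qed.

Fact quot_scaleA a b x : quot_scale a (quot_scale b x) = quot_scale (a * b) x.
Proof. by have [f ->] := quot_genP x; rewrite !quot_scale_pi mulrA. Qed.

Fact quot_scale1 : left_id 1 quot_scale.
Proof. by move=> x; have [f ->] := quot_genP x; rewrite quot_scale_pi mul1r. Qed.

Fact quot_scaleDr : right_distributive quot_scale +%R.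
Proof.
move=> a x y; have [f ->] := quot_genP x; have [h ->] := quot_genP y.
by rewrite -quot_genD !quot_scale_pi -quot_genD mulrDr.
Qed.

Fact quot_scaleDl x : {morph quot_scale^~ x : a b / a + b}.
Proof.
move=> a b; have [f ->] := quot_genP x.
by rewrite !quot_scale_pi -quot_genD mulrDl.
Qed.

HB.instance Definition _ := GRing.Zmodule_isLmodule.Build R quot_gen
  quot_scaleA quot_scale1 quot_scaleDr quot_scaleDl.

End Generated.

Section Modules.
Variable R : comNzRingType.

Definition prime_ideal (P : {pred R}) : Prop :=
  idealr_closed P /\ prime_idealr_closed P.

(* Chains of primes of R/I, seen as primes of R containing I. *)
Definition prime_chain (I : {pred R}) (n : nat) (P : nat -> {pred R}) : Prop :=
  [/\ {subset I <= P 0%N},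
      forall i, (i <= n)%N -> prime_ideal (P i) &
      forall i, (i < n)%N ->
        {subset P i <= P i.+1} /\ ~ {subset P i.+1 <= P i}].

(* The Krull dimension of R/I exists (is finite) and equals n. *)
Definition is_quot_dim (I : {pred R}) (n : nat) : Prop :=
  (exists P, prime_chain I n P) /\
  (forall m P, prime_chain I m P -> (m <= n)%N).

Variable M : lmodType R.

Definition annihilator : {pred R} := fun a => `[< forall u : M, a *: u = 0 >].

Definition is_dim (n : nat) : Prop := is_quot_dim annihilator n.

Definition associated_prime (P : {pred R}) : Prop :=
  prime_ideal P /\ exists u : M, forall a, (a \in P) = (a *: u == 0).

Definition is_indim (n : nat) : Prop :=
  (exists2 P, associated_prime P & is_quot_dim P n) /\
  (forall P m, associated_prime P -> is_quot_dim P m -> (n <= m)%N).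

(* u belongs to the submodule (f_1, ..., f_s)M *)
Definition in_span (f : seq R) (u : M) : Prop :=
  exists v : nat -> M, u = \sum_(j < size f) f`_j *: v j.

Definition regular_seq (f : seq R) : Prop :=
  (forall i, (i < size f)%N ->
     forall u : M, in_span (take i f) (f`_i *: u) -> in_span (take i f) u) /\
  (exists u : M, ~ in_span f u).

(* The maximal length of an M-regular sequence in J exists and equals n. *)
Definition is_depth (J : {pred R}) (n : nat) : Prop :=
  (exists f : seq R, [/\ {subset f <= J}, regular_seq f & size f = n]) /\
  (forall f : seq R, {subset f <= J} -> regular_seq f -> (size f <= n)%N).

End Modules.

Section StanleyReisner.
Variables (K : fieldType) (X : finType).

(* K[x : x in X], the variables being indexed through the enumeration of X *)
Definition polyX : comNzRingType := {mpoly K[#|X|]}.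

Definition varX (x : X) : polyX := 'X_(enum_rank x).

Definition irrelevant_ideal : {pred polyX} := ideal_gen predT varX.

Definition SR_module (Sigma : {set {set X}}) : lmodType polyX :=
  quot_gen (fun A : {set X} => A \notin Sigma)
           (fun A : {set X} => \prod_(x in A) varX x).

(* The depth of a graded module is its grade with respect to the irrelevant
   ideal; the regular sequences need not be homogeneous. *)
Definition initially_Cohen_Macaulay (M : lmodType polyX) : Prop :=
  exists n, is_depth M irrelevant_ideal n /\ is_indim M n.

Definition Cohen_Macaulay (M : lmodType polyX) : Prop :=
  exists n, is_depth M irrelevant_ideal n /\ is_dim M n.

End StanleyReisner.

Section Complexes.
Variable X : finType.
Implicit Types (Sigma : {set {set X}}) (S : seq {set X}) (e : rel X).

Definition face_dim (F : {set X}) : int := #|F|%:Z - 1.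

Definition complex_dim Sigma : int := (\max_(F in Sigma) #|F|)%N%:Z - 1.

Definition facets Sigma : {set {set X}} :=
  [set F | maxset (fun G => G \in Sigma) F].

Definition skeleton (k : int) Sigma : {set {set X}} :=
  [set F in Sigma | face_dim F <= k].

Definition clique_complex e : {set {set X}} :=
  [set F : {set X} | [forall x in F, forall y in F, (x != y) ==> e x y]].

(* Every cycle of length at least 4 has a chord: an edge joining two vertices
   of the cycle that are not consecutive on it. *)
Definition chordal e : Prop :=
  forall c : seq X, (4 <= size c)%N -> uniq c -> cycle e c ->
  exists x y, [/\ x \in c, y \in c, e x y, y != next c x & x != next c y].

(* The facets are numbered from 0 here: S_(m+1) is nth set0 S m. *)
Definition leaf_order Sigma S : Prop :=
  [/\ uniq S, S =i facets Sigma &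
      forall m, (0 < m < size S)%N ->
        exists2 p, (p < m)%N &
          forall i, (i < m)%N ->
            nth set0 S m :&: nth set0 S i \subset nth set0 S m :&: nth set0 S p].

(* For 1 <= m <= e - 1 this is (S_1 U ... U S_m) n S_(m+1). *)
Definition separator S (m : nat) : {set X} :=
  (\bigcup_(i < m) nth set0 S i) :&: nth set0 S m.

(* minimum of a nonempty sequence *)
Definition seq_min (s : seq nat) : nat := \big[minn/head 0%N s]_(n <- s) n.

Definition r_min S : nat :=
  seq_min [seq #|separator S m| | m <- iota 1 (size S).-1].

Definition n_min S : nat := seq_min [seq #|F| | F : {set X} <- S].

End Complexes.

(* Main.v *)
Require Import Defs.
From mathcomp Require Import all_boot all_order all_algebra.
From mathcomp Require Import ring zify.

Set Implicit Arguments.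
Unset Strict Implicit.
Unset Printing Implicit Defensive.

Import GRing.Theory.
Local Open Scope ring_scope.

(** Let [r] be the smallest size of a separator, [n] the smallest size of a facet,
    and [kap = k + 1] the largest number of vertices of a face of the skeleton. For
    [kap] between [0] and [dim Delta + 1] the skeleton has
      dimension [kap],  initial dimension [min kap n],  depth [min kap (r + 1)],
    and [r < n] because no facet contains another. Comparing the three numbers
    gives all the assertions. Only the depth is delicate.

    Ideals are treated as predicates, and membership in a Stanley-Reisner ideal is
    tested one coefficient at a time, so that deleting a vertex [v] or passing to
    its star becomes adding [x_v] to the ideal or taking its colon by [x_v].

    Depth at least [min kap (r + 1)]. The elementary symmetric polynomials
    [e_1, ..., e_t] in all the variables are used, because they form a regular
    sequence over every field. By the exact sequence
    [0 -> R/(I : x_v) -> R/I -> R/(I, x_v) -> 0] regularity is inherited from the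
    star and the deletion of [v] ([weakly_regular_colon]). Building the skeleton
    along the leaf order, one vertex at a time, each star is a skeleton of a simplex
    containing a separator and one more vertex, and all of it decomposes into
    simplices on at least [t] vertices ([weakly_regular_leaf_order]). On a simplex
    [G] the polynomial [e_|G|] becomes the product of the variables; dividing by it
    leaves the boundary of [G], which the same decomposition reduces to smaller
    simplices ([weakly_regular_simplex]).

    Depth at most [min kap (r + 1)]. If the irrelevant ideal contains a regular
    sequence of length [t], the Koszul complex of the [N] variables is exact in
    degrees above [N - t], since it is annihilated up to homotopy by that ideal
    ([koszul_exact]). The sequence need not be homogeneous. If [kap > r], a smallest
    separator disconnects the complex, and a Koszul cycle in degree [N - r - 1]
    detects it ([regular_length_separator]); if [kap <= r], the missing faces on
    [kap + 1] vertices of a facet give one in degree [N - kap]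
    ([regular_length_missing_face]).

    Dimensions. A chain of [m] strict inclusions of primes produces [(L + 1) ^ m]
    polynomials of degree [O(L)], linearly independent modulo the first prime. That
    prime contains all the variables outside some face [F], so at most
    [O(L ^ |F|)] of them can be independent, whence [m <= |F|]
    ([prime_chain_bound]). The associated primes are contained in primes of facets,
    which are themselves associated ([is_indim_SR_module]). *)

(** * Regular sequences modulo an ideal *)

Section RegularSequences.
Variable R : comNzRingType.
Implicit Types (I J : R -> Prop) (a b c f u v w : R) (fs : seq R).

Definition is_ideal I : Prop := I 0 /\ forall a u v, I u -> I v -> I (a * u + v).

Definition add_ideal I f : R -> Prop := fun u => exists v, I (u - f * v).

Definition colon I c : R -> Prop := fun u => I (c * u).

Fixpoint weakly_regular I fs : Prop :=
  if fs is f :: fs' then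
    (forall u, I (f * u) -> I u) /\ weakly_regular (add_ideal I f) fs'
  else True.

Lemma ideal_ext I J : (forall u, I u <-> J u) -> I = J.
Proof. by move=> IJ; apply/funext => u; apply/propext. Qed.

Section IdealTheory.
Variables (I : R -> Prop) (idI : is_ideal I).

Lemma ideal0 : I 0. Proof. by case: idI. Qed.

Lemma idealD u v : I u -> I v -> I (u + v).
Proof. by move=> Iu Iv; rewrite -[u]mul1r; apply: idI.2. Qed.

Lemma idealM a u : I u -> I (a * u).
Proof. by move=> Iu; rewrite -[_ * _]addr0; apply: idI.2 => //; apply: ideal0. Qed.

Lemma idealN u : I u -> I (- u).
Proof. by rewrite -mulN1r; apply: idealM. Qed.

Lemma idealB u v : I u -> I v -> I (u - v).
Proof. by move=> Iu Iv; apply/idealD/idealN. Qed.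

Lemma ideal_sum (T : Type) (r : seq T) (P : pred T) (F : T -> R) :
  (forall i, P i -> I (F i)) -> I (\sum_(i <- r | P i) F i).
Proof. by move=> IF; elim/big_ind: _ => //; [apply: ideal0|apply: idealD]. Qed.

Lemma idealBr u v : I (u - v) -> I u <-> I v.
Proof.
move=> Iuv; split=> [Iu|Iv]; last by rewrite -(subrK v u); apply: idealD.
by rewrite -(subKr u v); apply: idealB.
Qed.

Lemma add_ideal_is_ideal f : is_ideal (add_ideal I f).
Proof.
split=> [|a u v [x Ix] [y Iy]]; first by exists 0; rewrite mulr0 subr0; apply: ideal0.
exists (a * x + y).
have ->: a * u + v - f * (a * x + y) = a * (u - f * x) + (v - f * y) by ring.
exact: idI.2.
Qed.

Lemma sub_add_ideal f u : I u -> add_ideal I f u.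
Proof. by move=> Iu; exists 0; rewrite mulr0 subr0. Qed.

Lemma add_ideal_gen f : add_ideal I f f.
Proof. by exists 1; rewrite mulr1 subrr; apply: ideal0. Qed.

Lemma eq_add_ideal f g : I (f - g) -> add_ideal I f = add_ideal I g.
Proof.
move=> Ifg; apply: ideal_ext => u; split=> -[v Iv]; exists v.
  have ->: u - g * v = v * (f - g) + (u - f * v) by ring.
  exact: idI.2.
have ->: u - f * v = - v * (f - g) + (u - g * v) by ring.
exact: idI.2.
Qed.

End IdealTheory.

Lemma add_idealC I f g : add_ideal (add_ideal I f) g = add_ideal (add_ideal I g) f.
Proof.
by apply: ideal_ext => u; split=> -[v [w Iw]]; exists w; exists v; rewrite addrAC.
Qed.

Lemma weakly_regular_cat I fs gs :
  weakly_regular I (fs ++ gs) <->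
  weakly_regular I fs /\ weakly_regular (foldl add_ideal I fs) gs.
Proof.
elim: fs I => [|f fs IH] I /=; first by split=> // -[].
by rewrite IH; split=> [[? []]|[[]]].
Qed.

Lemma weakly_regularP I fs : weakly_regular I fs <->
  forall i, (i < size fs)%N -> forall u,
    foldl add_ideal I (take i fs) (fs`_i * u) -> foldl add_ideal I (take i fs) u.
Proof.
elim: fs I => [|f fs IH] I //=; rewrite IH.
split=> [[reg_f reg_fs] [|i] // /reg_fs //|reg].
by split=> [|i]; [apply: (reg 0)|apply: (reg i.+1)].
Qed.

(** In the exact sequence [0 -> R/(I : c) -> R/I -> R/(I + c) -> 0], whose first
    map is multiplication by [c], regularity on the outer terms passes to the
    middle one; it also keeps the sequence exact modulo the first element, which
    is what makes the induction run. *)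
Lemma weakly_regular_colon I c fs : is_ideal I ->
  weakly_regular (colon I c) fs -> weakly_regular (add_ideal I c) fs ->
  weakly_regular I fs.
Proof.
elim: fs I => [//|f fs IH] I idI /= [colon_f colon_fs] [add_f add_fs].
have Hf u : I (f * u) -> I u.
  move=> Ifu; have [v Iv] : add_ideal I c u by apply/add_f/sub_add_ideal.
  have: colon I c v.
    apply: colon_f; rewrite /colon.
    have ->: c * (f * v) = f * u - f * (u - c * v) by ring.
    by apply: idealB => //; apply: idealM.
  move=> Icv; rewrite -(subrK (c * v) u); exact: idealD.
split=> //; apply: IH; first exact: add_ideal_is_ideal.
  suff ->: colon (add_ideal I f) c = add_ideal (colon I c) f by [].
  apply: ideal_ext => u; split=> [[w Iw]|[w Iw]]; last first.
    by exists (c * w); rewrite mulrCA -mulrBr.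
  have [w' Iw'] : add_ideal I c w.
    apply: add_f; exists u; rewrite -opprB; exact: idealN.
  exists w'; rewrite /colon.
  have ->: c * (u - f * w') = (c * u - f * w) + f * (w - c * w') by ring.
  by apply: idealD => //; apply: idealM.
by rewrite add_idealC.
Qed.

End RegularSequences.

(** * Reordering homogeneous regular sequences *)

Section Homogeneous.
Variables (n : nat) (K : fieldType).
Local Notation R := {mpoly K[n]}.
Implicit Types (I : R -> Prop) (a b f u v w : R) (fs : seq R).

Lemma mcoeff_filter (P : pred 'X_{1..n}) f m :
  (\sum_(k <- msupp f | P k) f@_k *: 'X_[k])@_m = if P m then f@_m else 0.
Proof.
rewrite raddf_sum /= big_mkcond /=.
have term k : (if P k then (f@_k *: 'X_[k])@_m else 0) =
    if P m then (f@_k *: 'X_[k])@_m else 0.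
  by rewrite mcoeffZ mcoeffX; case: (k =P m) => [->|] //; rewrite mulr0 !if_same.
rewrite (eq_bigr _ (fun k _ => term k)); case: ifP => _; last by rewrite big1.
by rewrite [X in _ = X@__]mpolyE raddf_sum.
Qed.

Lemma mcoeff_pihomog d f m : (pihomog mdeg d f)@_m = if mdeg m == d then f@_m else 0.
Proof. by rewrite pihomogE mcoeff_filter. Qed.

Lemma pihomogM e d f u : f \is e.-homog for mdeg ->
  pihomog mdeg d (f * u) = if (e <= d)%N then f * pihomog mdeg (d - e) u else 0.
Proof.
move=> homf.
rewrite {1}(pihomog_partitionE (leqnn (msize u))) mulr_sumr raddf_sum /=.
have homM k : f * pihomog mdeg k u \is (e + k).-homog for mdeg.
  by apply: dhomogM => //; apply: pihomogP.
case: leqP => [le_ed|lt_de]; last first.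
  rewrite big1 // => k _; apply: (pihomog_ne0 _ (homM k)).
  by rewrite eq_sym; apply/eqP=> ek; rewrite ek ltnNge leq_addr in lt_de.
have vanish k : k != (d - e)%N -> pihomog mdeg d (f * pihomog mdeg k u) = 0.
  move=> ne; apply: (pihomog_ne0 _ (homM k)).
  by apply: contraNneq ne => <-; rewrite addKn.
case: (ltnP (d - e) (msize u)) => [lt|ge].
  rewrite (bigD1 (Ordinal lt)) //= big1 ?addr0 => [|k ne]; last first.
    by apply: vanish; apply: contraNneq ne => eqk; apply/eqP/val_inj.
  by apply: pihomog_dE; have := homM (d - e)%N; rewrite subnKC.
rewrite big1 => [|k _]; last by apply: vanish; rewrite ltn_eqF // (leq_trans _ ge).
suff ->: pihomog mdeg (d - e) u = 0 by rewrite mulr0.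
apply/mpolyP=> m; rewrite mcoeff_pihomog mcoeff0; case: eqP => // dm.
by apply/memN_msupp_eq0/msize_mdeg_ge; rewrite dm.
Qed.

Definition homogeneous_ideal I : Prop := forall d u, I u -> I (pihomog mdeg d u).

Lemma homogeneous_add_ideal I e f : f \is e.-homog for mdeg ->
  homogeneous_ideal I -> homogeneous_ideal (add_ideal I f).
Proof.
move=> homf homI d u [v Iv].
have := homI d _ Iv; rewrite pihomogB (pihomogM _ _ homf).
case: leqP => _ h; first by exists (pihomog mdeg (d - e) v).
by exists 0; rewrite mulr0.
Qed.

(** Take [u] homogeneous with [b * u] in [I], so that [u] lies in [I + (a)]. In its
    own degree, [u = i + a * w] with [i] in [I] and [w] of lower degree; then
    [a * (b * w)] lies in [I], hence so does [b * w], and one descends to [w]. *)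
Lemma homogeneous_swap I d a e b : is_ideal I -> homogeneous_ideal I ->
  a \is d.+1.-homog for mdeg -> b \is e.-homog for mdeg ->
  (forall u, I (a * u) -> I u) ->
  (forall u, add_ideal I a (b * u) -> add_ideal I a u) ->
  (forall u, I (b * u) -> I u) /\
  (forall u, add_ideal I b (a * u) -> add_ideal I b u).
Proof.
move=> idI homI homa homb rega regb.
have regb0 u : I (b * u) -> I u.
  have homog_case k : forall w, w \is k.-homog for mdeg -> I (b * w) -> I w.
    have [l] := ubnP k; elim: l k => // l IH k /ltnSE le_kl w homw Ibw.
    have [v Iv] : add_ideal I a w by apply/regb/sub_add_ideal.
    have := homI k _ Iv; rewrite pihomogB (pihomogM _ _ homa) (pihomog_dE homw).
    case: (leqP d.+1 k) => [lt_dk Iv'|_]; last by rewrite subr0.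
    have Iv'' : I (pihomog mdeg (k - d.+1) v).
      apply: (IH (k - d.+1)%N); first by lia.
        exact: pihomogP.
      apply: rega; set v' := pihomog _ _ _ in Iv' *.
      have ->: a * (b * v') = b * w - b * (w - a * v') by ring.
      by apply: idealB => //; apply: idealM.
    rewrite -(subrK (a * pihomog mdeg (k - d.+1) v) w).
    by apply: idealD => //; apply: idealM.
  move=> Ibu; rewrite (pihomog_partitionE (leqnn (msize u))).
  apply: ideal_sum => // k _; apply: (homog_case k); first exact: pihomogP.
  by have := homI (e + k)%N _ Ibu; rewrite (pihomogM _ _ homb) leq_addr addKn.
split=> // u [w Iw].
have [w' Iw'] : add_ideal I a w.
  by apply: regb; exists u; rewrite -opprB; apply: idealN.
exists w'; apply: rega.
have ->: a * (u - b * w') = (a * u - b * w) + b * (w - a * w') by ring.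
by apply: idealD => //; apply: idealM.
Qed.

Lemma homogeneous_weakly_regular_rcons I d a fs :
  is_ideal I -> homogeneous_ideal I -> a \is d.+1.-homog for mdeg ->
  (forall f, f \in fs -> exists e, f \is e.-homog for mdeg) ->
  weakly_regular I (a :: fs) -> weakly_regular I (rcons fs a).
Proof.
elim: fs I => [//|b fs IH] I idI homI homa homfs [rega [regb reg_fs]].
have [e homb] := homfs b (mem_head _ _).
have [regb' rega'] := homogeneous_swap idI homI homa homb rega regb.
split=> //; apply: IH => //; first exact: add_ideal_is_ideal.
- exact: homogeneous_add_ideal homb _.
- by move=> f fs_f; apply: homfs; rewrite inE fs_f orbT.
- by split=> //; rewrite add_idealC.
Qed.

End Homogeneous.

(** * Stanley-Reisner ideals, read off coefficients *)

Section Monomials.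
Variable X : finType.
Local Notation mon := 'X_{1..#|X|}.
Implicit Types (m : mon) (A B C F G : {set X}).

Definition msupport m : {set X} := [set x | m (enum_rank x) != 0%N].

Definition mset C : mon := [multinom (enum_val i \in C : nat) | i < #|X|].

Lemma msupport0 : msupport 0%MM = set0.
Proof. by apply/setP=> x; rewrite !inE mnm0E eqxx. Qed.

Lemma msupportD m1 m2 : msupport (m1 + m2)%MM = msupport m1 :|: msupport m2.
Proof. by apply/setP=> x; rewrite !inE mnmDE addn_eq0 negb_and. Qed.

Lemma msetE C x : mset C (enum_rank x) = (x \in C).
Proof. by rewrite mnmE enum_rankK. Qed.

Lemma msupport_mset C : msupport (mset C) = C.
Proof. by apply/setP=> x; rewrite inE msetE; case: (x \in C). Qed.

Lemma mset0 : mset set0 = 0%MM.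
Proof. by apply/mnmP=> i; rewrite mnmE mnm0E inE. Qed.

Lemma mset_inj : injective mset.
Proof. by move=> A B AB; rewrite -(msupport_mset A) AB msupport_mset. Qed.

Lemma mset_le C m : (mset C <= m)%MM = (C \subset msupport m).
Proof.
apply/mnm_lepP/subsetP => [le x xC|sub i].
  by rewrite inE -lt0n (leq_trans _ (le _)) // msetE xC.
rewrite mnmE; case: (boolP (enum_val i \in C)) => // /sub.
by rewrite inE enum_valK lt0n.
Qed.

Lemma msetD A B : [disjoint A & B] -> (mset A + mset B)%MM = mset (A :|: B).
Proof.
move=> dAB; apply/mnmP=> i; rewrite mnmDE !mnmE inE.
by case: (boolP (_ \in A)) => // /(disjointFr dAB) ->.
Qed.

End Monomials.

Section StanleyReisnerIdeal.
Variables (K : fieldType) (X : finType).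
Local Notation R := {mpoly K[#|X|]}.
Implicit Types (Sigma : {set {set X}}) (A B C F G : {set X}) (f g u v : R).

Definition xmon C : R := 'X_[mset C].

Definition simplicial Sigma : Prop :=
  forall A B, A \subset B -> B \in Sigma -> A \in Sigma.

(** The ideal spanned by the monomials whose support is not a face; for a
    complex this is the Stanley-Reisner ideal, and membership can be tested
    one coefficient at a time. *)
Definition SR_ideal Sigma f : Prop :=
  forall m, msupport m \in Sigma -> f@_m = 0.

Lemma SR_ideal_is_ideal Sigma : simplicial Sigma -> is_ideal (SR_ideal Sigma).
Proof.
move=> simp; split=> [m _|a u v Iu Iv m mS]; first exact: mcoeff0.
rewrite mcoeffD Iv // addr0 mcoeffM big1 // => k /eqP def_m.
have def_s := congr1 (@msupport X) def_m.
by rewrite [u@_ _]Iu ?mulr0 // (simp _ _ _ mS) // def_s msupportD subsetUr.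
Qed.

Lemma SR_ideal_homogeneous Sigma : homogeneous_ideal (SR_ideal Sigma).
Proof. by move=> d u Iu m mS; rewrite mcoeff_pihomog Iu // if_same. Qed.

Lemma SR_ideal_sub Sigma Sigma' f :
  {subset Sigma' <= Sigma} -> SR_ideal Sigma f -> SR_ideal Sigma' f.
Proof. by move=> sub If m /sub; apply: If. Qed.

Lemma mcoeff_xmonM C f m :
  (xmon C * f)@_m = if C \subset msupport m then f@_(m - mset C)%MM else 0.
Proof.
rewrite mulrC -mset_le; case: ifP => [le|/negP nle].
  by rewrite -{1}(submK le) addmC mcoeffMX.
apply/eqP; rewrite mcoeff_eq0; apply/negP; rewrite (perm_mem (msuppMX _ _)).
by case/mapP=> m' _ def_m; apply: nle; rewrite def_m lem_addr.
Qed.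

Lemma xmonM A B : [disjoint A & B] -> xmon A * xmon B = xmon (A :|: B).
Proof. by move=> dAB; rewrite /xmon -mpolyXD msetD. Qed.

Lemma mcoeff_xmon A B : (xmon A)@_(mset B) = (A == B)%:R.
Proof. by rewrite mcoeffX (inj_eq (@mset_inj X)). Qed.

Lemma SR_ideal_xmon Sigma C : C \notin Sigma -> SR_ideal Sigma (xmon C).
Proof.
move=> CS m mS; rewrite mcoeffX; case: eqP => // Cm.
by rewrite -Cm msupport_mset (negbTE CS) in mS.
Qed.

Lemma colon_SR_ideal Sigma C :
  colon (SR_ideal Sigma) (xmon C) = SR_ideal [set F | C :|: F \in Sigma].
Proof.
apply: ideal_ext => u; split=> [Iu m|Iu m mS]; last first.
  rewrite mcoeff_xmonM; case: ifP => // le; apply: Iu.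
  rewrite inE; suff -> : C :|: msupport (m - mset C)%MM = msupport m by [].
  by rewrite -[in RHS](submK (m := mset C) (m' := m)) ?mset_le // msupportD
     msupport_mset setUC.
rewrite inE => CmS; have := Iu (mset C + m)%MM.
rewrite msupportD msupport_mset => /(_ CmS).
by rewrite mcoeff_xmonM msupportD msupport_mset subsetUl addmC addmK.
Qed.

Lemma divide_xmon C f :
  exists g, forall m, (f - xmon C * g)@_m = if C \subset msupport m then 0 else f@_m.
Proof.
exists (\sum_(m <- msupp f | C \subset msupport m) f@_m *: 'X_[m - mset C]) => m.
rewrite mcoeffB mulr_sumr raddf_sum /=.
have term m' : C \subset msupport m' ->
    (xmon C * (f@_m' *: 'X_[m' - mset C]))@_m = f@_m' * (m' == m)%:R.
  move=> le; rewrite -scalerAr mcoeffZ /xmon -mpolyXD mcoeffX addmC submK //.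
  by rewrite mset_le.
have -> : \sum_(m' <- msupp f | C \subset msupport m')
    (xmon C * (f@_m' *: 'X_[m' - mset C]))@_m =
    (\sum_(m' <- msupp f | C \subset msupport m') f@_m' *: 'X_[m'])@_m.
  by rewrite raddf_sum; apply: eq_bigr => m' /term ->; rewrite /= mcoeffZ mcoeffX.
by rewrite mcoeff_filter; case: ifP; rewrite ?subrr ?subr0.
Qed.

Lemma add_SR_ideal Sigma C :
  add_ideal (SR_ideal Sigma) (xmon C) = SR_ideal [set F in Sigma | ~~ (C \subset F)].
Proof.
apply: ideal_ext => u; split=> [[v Iv] m|Iu].
  rewrite inE => /andP[mS /negbTE nle]; have := Iv m mS.
  by rewrite mcoeffB mcoeff_xmonM nle subr0.
have [g Hg] := divide_xmon C u; exists g => m mS; rewrite Hg.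
by case: ifP => // nle; apply: Iu; rewrite inE mS nle.
Qed.

Lemma prod_varX A : \prod_(x in A) varX K x = xmon A.
Proof.
rewrite /xmon mpolyXE_id (reindex _ (onW_bij _ (@enum_rank_bij X))) /= big_mkcond /=.
by apply: eq_bigr => x _; rewrite msetE; case: ifP.
Qed.

Lemma varXE x : varX K x = xmon [set x].
Proof. by rewrite -prod_varX big_set1. Qed.

Lemma SR_idealP Sigma f : simplicial Sigma ->
  reflect (SR_ideal Sigma f)
    (f \in ideal_gen (fun A : {set X} => A \notin Sigma)
                     (fun A => \prod_(x in A) varX K x)).
Proof.
move=> simp; have idI := SR_ideal_is_ideal simp.
apply: (iffP idP) => [/asboolP[c ->]|If].
  apply: (ideal_sum idI) => A AS; apply: (idealM idI).
  by rewrite prod_varX; apply: SR_ideal_xmon.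
rewrite (mpolyE f) big_seq; apply: rpred_sum => m mf.
have mS : msupport m \notin Sigma.
  by apply/negP=> mS; rewrite mcoeff_msupp If // eqxx in mf.
have le : (mset (msupport m) <= m)%MM by rewrite mset_le.
rewrite -(submK le) mpolyXD scalerAl; apply: ideal_genM.
apply/asboolP; exists (fun A => (A == msupport m)%:R).
rewrite (bigD1 (msupport m)) //= eqxx mul1r prod_varX big1 ?addr0 // => A.
by case/andP=> _ /negbTE ->; rewrite mul0r.
Qed.

End StanleyReisnerIdeal.

(** * Lower bound: elementary symmetric polynomials form regular sequences *)

Section LowerBound.
Variables (K : fieldType) (X : finType).
Local Notation R := {mpoly K[#|X|]}.
Implicit Types (Sigma Gamma : {set {set X}}) (C F G Q U V : {set X}).

Definition esyms t : seq R := [seq mesym #|X| K i.+1 | i <- iota 0 t].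

Lemma esymsS t : esyms t.+1 = rcons (esyms t) (mesym #|X| K t.+1).
Proof. by rewrite /esyms -cats1 -[in iota _ _]addn1 iotaD map_cat. Qed.

Lemma esyms_cat t s : (t <= s)%N -> exists fs, esyms s = esyms t ++ fs.
Proof.
move=> le_ts; exists [seq mesym #|X| K i.+1 | i <- iota t (s - t)].
by rewrite /esyms -map_cat -{2}(add0n t) -iotaD subnKC.
Qed.

Lemma simplicial_powerset G : simplicial (powerset G).
Proof. by move=> A B AB; rewrite !powersetE; apply: subset_trans. Qed.

(** The faces of size at most [kap] of a simplex on [V], joined with the
    simplex on [C], the bound counting the vertices of [C] as present. *)
Definition skeleton_join kap C V : {set {set X}} :=
  [set F : {set X} | (F \subset C :|: V) && (#|C :|: F| <= kap)%N].

Lemma simplicial_skeleton_join kap C V : simplicial (skeleton_join kap C V).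
Proof.
move=> A B AB; rewrite !inE => /andP[BV kB]; rewrite (subset_trans AB) //=.
by apply: leq_trans kB; apply/subset_leq_card/setUS.
Qed.

(** Deletion and star of a vertex of [V] are again skeleton joins, with one vertex
    less in [V]; the recursion ends at simplices, none of which has fewer than
    [t] or more than [kap] vertices. *)
Lemma weakly_regular_skeleton_join kap t (fs : seq R) C V :
  (forall G, t <= #|G| <= kap -> weakly_regular (SR_ideal (powerset G)) fs)%N ->
  (t <= kap)%N -> [disjoint C & V] -> (t <= #|C :|: V|)%N -> (#|C| <= kap)%N ->
  weakly_regular (SR_ideal (skeleton_join kap C V)) fs.
Proof.
move=> simplex le_t; have [n] := ubnP #|V|; elim: n V C => // n IH V C.
move=> /ltnSE le_n dCV le_tCV le_C.
have [le_CV|lt_CV] := leqP #|C :|: V| kap.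
  suff ->: skeleton_join kap C V = powerset (C :|: V) by apply: simplex; apply/andP.
  apply/setP=> F; rewrite !inE; apply: andb_idr => FCV.
  by apply: leq_trans le_CV; rewrite subset_leq_card // subUset subsetUl.
move: le_C; rewrite leq_eqVlt => /orP[/eqP eq_C|lt_C].
  suff ->: skeleton_join kap C V = powerset C by apply: simplex; rewrite eq_C leqnn le_t.
  apply/setP=> F; rewrite !inE -eq_C.
  apply/andP/idP => [[_ leCF]|FC]; last by rewrite (setUidPl FC) subsetU ?FC.
  by apply/setUidPl/eqP; rewrite eq_sym eqEcard subsetUl.
have [v vV] : exists v, v \in V.
  apply/set0Pn; apply: contraTneq lt_CV => ->.
  by rewrite setU0 -leqNgt ltnW.
have vC : v \notin C by rewrite (disjointFl dCV).
have V1 : (#|V :\ v| < n)%N by move: le_n; rewrite (cardsD1 v V) vV.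
have dC1 : [disjoint C & V :\ v] by apply: disjointWr dCV; apply: subD1set.
apply: (@weakly_regular_colon _ _ (xmon K [set v])).
- exact/SR_ideal_is_ideal/simplicial_skeleton_join.
- rewrite colon_SR_ideal.
  suff ->: [set F | [set v] :|: F \in skeleton_join kap C V] =
           skeleton_join kap (v |: C) (V :\ v).
    apply: IH => //.
    + rewrite disjoints_subset subUset sub1set !inE eqxx /=.
      by rewrite -disjoints_subset.
    + by rewrite -setUA setUCA setD1K.
    + by rewrite cardsU1 vC.
  apply/setP=> F; rewrite !inE subUset sub1set inE vV orbT /=.
  by rewrite -(setD1K vV) setUCA setUA setD1K // [C :|: (_ :|: _)]setUCA setUA.
- rewrite add_SR_ideal.
  suff ->: [set F in skeleton_join kap C V | ~~ ([set v] \subset F)] =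
           skeleton_join kap C (V :\ v).
    apply: IH => //; last exact: ltnW.
    have : #|C :|: V| = #|C :|: V :\ v|.+1.
      rewrite -{1}(setD1K vV) setUCA cardsU1.
      by rewrite !inE eqxx (negbTE vC).
    by move=> card_CV; apply: leq_trans le_t _; rewrite -ltnS -card_CV.
  apply/setP=> F; rewrite !inE sub1set andbAC; congr (_ && _).
  have -> : C :|: V :\ v = (C :|: V) :\ v.
    by apply/setP=> x; rewrite !inE; case: eqP => //= ->; rewrite (negbTE vC).
  by rewrite subsetD1.
Qed.

(** Among the squarefree monomials of degree [#|G|], the product of the variables
    of [G] is the only one supported in [G]. *)
Lemma mesym_mod_simplex G :
  SR_ideal (powerset G) (mesym #|X| K #|G| - xmon K G).
Proof.
move=> m; rewrite powersetE => mG; rewrite mcoeffB mcoeff_mesym mcoeffX.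
apply/eqP; rewrite subr_eq0; apply/eqP; congr (_%:R); congr nat_of_bool.
rewrite mecharP; apply/existsP/eqP => [[h /andP[/eqP def_m /eqP card_h]]|<-].
  have hE x : (x \in msupport m) = (enum_rank x \in h).
    by rewrite inE def_m mnmE; case: (_ \in h).
  suff -> : G = msupport m.
    by apply/mnmP=> i; rewrite mnmE hE enum_valK def_m mnmE.
  apply/esym/eqP; rewrite eqEcard mG -card_h.
  rewrite -(card_imset _ (can_inj (@enum_rankK X))).
  apply/subset_leq_card/subsetP=> i ih; apply/imsetP.
  by exists (enum_val i); rewrite ?enum_valK // hE enum_valK.
exists (enum_rank @: G); rewrite card_imset ?eqxx ?andbT; last exact: enum_rank_inj.
apply/eqP/mnmP=> i; rewrite !mnmE; congr nat_of_bool.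
by rewrite -{2}(enum_valK i) mem_imset //; apply: enum_rank_inj.
Qed.

(** Modulo the variables outside [G], the last elementary symmetric polynomial is
    the product of the variables in [G]: a nonzerodivisor whose quotient is the
    boundary of the simplex. The others are regular there, by induction, and
    homogeneity lets the product be moved from the first place to the last. *)
Lemma weakly_regular_simplex G t : (t <= #|G|)%N ->
  weakly_regular (SR_ideal (powerset G)) (esyms t).
Proof.
have [n] := ubnP #|G|; elim: n G t => // n IH G t /ltnSE le_n le_t.
suff full : weakly_regular (SR_ideal (powerset G)) (esyms #|G|).
  have [fs def_fs] := esyms_cat le_t; move: full.
  by rewrite def_fs weakly_regular_cat => -[].
have idI : is_ideal (SR_ideal (K := K) (powerset G)).
  exact/SR_ideal_is_ideal/simplicial_powerset.
case card_G : #|G| => [//|s]; rewrite esymsS.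
apply: (homogeneous_weakly_regular_rcons (d := s)) => //.
- exact: SR_ideal_homogeneous.
- exact: dhomog_mesym.
- by move=> f /mapP[i _ ->]; exists i.+1; apply: dhomog_mesym.
rewrite -card_G; have modG := @mesym_mod_simplex G; split=> [u Iu|].
  have: colon (SR_ideal (powerset G)) (xmon K G) u.
    rewrite /colon -(idealBr idI (u := mesym #|X| K #|G| * u)) // -mulrBl mulrC.
    exact: (idealM idI).
  rewrite colon_SR_ideal; apply: SR_ideal_sub => F.
  by rewrite !inE subUset subxx.
(* The proper subsets of [G] are the faces of size at most [s] of the simplex. *)
rewrite (eq_add_ideal idI modG) add_SR_ideal.
suff -> : [set F in powerset G | ~~ (G \subset F)] = skeleton_join s set0 G.
  apply: (@weakly_regular_skeleton_join s s); rewrite ?set0U ?cards0 ?card_G //.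
    move=> G' /andP[le_s ge_s]; apply: IH => //.
    by rewrite (leq_ltn_trans ge_s) // -card_G.
  by rewrite -setI_eq0 set0I.
apply/setP=> F; rewrite !inE !set0U; apply: andb_id2l => FG.
by rewrite -ltnS -card_G ltnNge; congr (~~ _); apply/idP/idP => [/subset_leq_card|leGF];
  rewrite // (eqP (_ : F == G)) // eqEcard FG.
Qed.

(** Attaching a face along [Q], one new vertex at a time: the deletion of a new
    vertex is the previous complex, and its star meets only the new face. *)
Lemma weakly_regular_attach kap t Gamma Q U :
  simplicial Gamma -> (0 < kap)%N -> (t <= kap)%N -> (t <= #|Q|.+1)%N ->
  (forall F, F \in Gamma -> [disjoint U & F]) -> [disjoint U & Q] ->
  skeleton_join kap set0 Q \subset Gamma ->
  weakly_regular (SR_ideal Gamma) (esyms t) ->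
  weakly_regular (SR_ideal (Gamma :|: skeleton_join kap set0 (Q :|: U))) (esyms t).
Proof.
move=> simp kap_gt0 le_t le_tQ; have [n] := ubnP #|U|.
elim: n U => // n IH U /ltnSE le_n newU dUQ sub_Q reg.
have [->|[v vU]] := set_0Vmem U.
  by rewrite setU0 (setUidPl sub_Q).
have vQ : v \notin Q by rewrite (disjointFr dUQ).
have vG F : F \in Gamma -> v \notin F by move/newU/disjointFr => ->.
have U1 : (#|U :\ v| < n)%N by move: le_n; rewrite (cardsD1 v U) vU.
apply: (@weakly_regular_colon _ _ (xmon K [set v])).
- apply/SR_ideal_is_ideal => A B AB; rewrite !in_setU => /orP[/(simp _ _ AB) -> //|].
  by move/(simplicial_skeleton_join AB) => ->; rewrite orbT.
- rewrite colon_SR_ideal.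
  suff ->: [set F | [set v] :|: F \in Gamma :|: skeleton_join kap set0 (Q :|: U)] =
           skeleton_join kap [set v] (Q :|: U :\ v).
    apply: (@weakly_regular_skeleton_join _ t) => //; rewrite ?cards1 //.
    + by move=> G /andP[le_tG _]; apply: weakly_regular_simplex.
    + by rewrite disjoints1 !inE eqxx (negbTE vQ).
    + rewrite cardsU1 !inE eqxx (negbTE vQ) add1n.
      by apply: leq_trans le_tQ _; rewrite ltnS subset_leq_card ?subsetUl.
  apply/setP=> F; rewrite !inE !set0U.
  have /negbTE -> : [set v] :|: F \notin Gamma.
    by apply/negP=> /vG; rewrite !inE eqxx.
  rewrite /= subUset sub1set !inE vU orbT /=.
  by rewrite setUCA setD1K.
- rewrite add_SR_ideal.
  suff ->: [set F in Gamma :|: skeleton_join kap set0 (Q :|: U) | ~~ ([set v] \subset F)] =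
           Gamma :|: skeleton_join kap set0 (Q :|: U :\ v).
    apply: IH => //; last by apply: disjointWl dUQ; apply: subD1set.
    by move=> F /newU; apply: disjointWl; apply: subD1set.
  apply/setP=> F; rewrite !inE !set0U sub1set.
  have -> : Q :|: U :\ v = (Q :|: U) :\ v.
    by apply/setP=> x; rewrite !inE; case: eqP => //= ->; rewrite (negbTE vQ).
  rewrite subsetD1; case: (boolP (F \in Gamma)) => [/vG -> //|_] /=.
  by rewrite andbAC.
Qed.

Definition generated_skeleton kap (S : seq {set X}) : {set {set X}} :=
  [set F : {set X} | (#|F| <= kap)%N && has (fun G => F \subset G) S].

Lemma simplicial_generated_skeleton kap S : simplicial (generated_skeleton kap S).
Proof.
move=> A B AB; rewrite !inE => /andP[le_B /hasP[G SG BG]].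
rewrite (leq_trans (subset_leq_card AB)) //=; apply/hasP; exists G => //.
exact: subset_trans BG.
Qed.

Lemma generated_skeleton_rcons kap S G :
  generated_skeleton kap (rcons S G) =
  generated_skeleton kap S :|: skeleton_join kap set0 G.
Proof.
apply/setP=> F; rewrite !inE !set0U has_rcons andb_orr orbC.
by congr (_ || _); apply: andbC.
Qed.

(** Each new set is attached to the union of the previous ones along its separator,
    which is a face of that union because it lies in the parent. *)
Lemma weakly_regular_leaf_order kap t S :
  (0 < size S)%N -> (t <= kap)%N -> (t <= #|nth set0 S 0|)%N ->
  (forall m, 0 < m < size S -> t <= #|separator S m|.+1)%N ->
  (forall m, (0 < m < size S)%N ->
    exists2 p, (p < m)%N & separator S m \subset nth set0 S p) ->
  weakly_regular (SR_ideal (generated_skeleton kap S)) (esyms t).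
Proof.
move=> S_gt0 le_t le_t0 le_tm sep_sub.
have [->//|t_gt0] := posnP t; have kap_gt0 := leq_trans t_gt0 le_t.
suff take_reg m : (m < size S)%N ->
    weakly_regular (SR_ideal (generated_skeleton kap (take m.+1 S))) (esyms t).
  by have := take_reg (size S).-1; rewrite prednK // leqnn take_size; apply.
elim: m => [|m IH] lt_m.
  rewrite (take_nth set0) // take0 generated_skeleton_rcons.
  have -> : generated_skeleton kap [::] = set0.
    by apply/setP=> F; rewrite !inE andbF.
  rewrite set0U; apply: (@weakly_regular_skeleton_join _ t) => //.
  - by move=> G /andP[le_tG _]; apply: weakly_regular_simplex.
  - by rewrite -setI_eq0 set0I.
  - by rewrite set0U.
  - by rewrite cards0.
rewrite (take_nth set0) // generated_skeleton_rcons.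
set Q := separator S m.+1; set G := nth set0 S m.+1.
have -> : G = Q :|: (G :\: Q).
  by rewrite -{1}(setID G Q) (setIidPr _) // subsetIr.
have [p lt_p Qp] := sep_sub m.+1 lt_m.
apply: weakly_regular_attach => //.
- exact: simplicial_generated_skeleton.
- exact: le_tm.
- move=> F; rewrite inE => /andP[_ /(has_nthP set0)[i lt_i]].
  rewrite size_takel in lt_i; last exact: ltnW.
  rewrite nth_take // => FS; rewrite -setI_eq0; apply/eqP/setP=> x; rewrite !inE.
  apply/negP=> /andP[/andP[nxQ xG] /(subsetP FS) xS]; case/negP: nxQ.
  by rewrite xG andbT; apply/bigcupP; exists (Ordinal lt_i).
- by rewrite disjoints_subset setDE subsetIr.
- apply/subsetP=> F; rewrite !inE !set0U => /andP[FQ ->] /=.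
  apply/(has_nthP set0); exists p.
    by rewrite size_takel // ltnW.
  by rewrite nth_take //; apply: subset_trans Qp.
- by apply: IH; apply: ltnW.
Qed.

End LowerBound.

(** * The Koszul complex and the vanishing forced by a regular sequence *)

Section Koszul.
Variables (R : comNzRingType) (X : finType).
Implicit Types (T : {set X}) (i l : X) (c a x : X -> R) (z y : {set X} -> R).

Definition koszul_sign i T : R :=
  (-1) ^+ #|[set l in T | (enum_rank l < enum_rank i)%N]|.

(** A function on sets of variables stands for the element of the exterior
    algebra with these coordinates; [koszul_d] contracts with the linear form [c]
    and [koszul_s] multiplies by the vector [a]. *)
Definition koszul_d c z T : R :=
  \sum_(i | i \notin T) koszul_sign i T * c i * z (i |: T).

Definition koszul_s a z T : R :=
  \sum_(i | i \in T) koszul_sign i T * a i * z (T :\ i).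

Lemma koszul_sign_sqr i T : koszul_sign i T * koszul_sign i T = 1.
Proof. by rewrite -expr2 sqrr_sign. Qed.

Lemma koszul_signU1 i l T : l \notin T ->
  koszul_sign i (l |: T) = (-1) ^+ (enum_rank l < enum_rank i)%N * koszul_sign i T.
Proof.
move=> lT; rewrite /koszul_sign -exprD; congr (_ ^+ _).
have -> : [set l0 in l |: T | (enum_rank l0 < enum_rank i)%N] =
  (if (enum_rank l < enum_rank i)%N then [set l] else set0) :|:
  [set l0 in T | (enum_rank l0 < enum_rank i)%N].
  apply/setP=> j; rewrite !inE andb_orl; congr (_ || _).
  case: (j =P l) => [->|/eqP/negbTE ne]; case: ifP => _; by rewrite !inE ?eqxx ?ne.
by case: ifP => _; rewrite ?set0U // cardsU1 inE (negbTE lT).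
Qed.

Lemma koszul_sign_swap i l T : i != l -> i \notin T -> l \notin T ->
  koszul_sign l T * koszul_sign i (l |: T) = - (koszul_sign i T * koszul_sign l (i |: T)).
Proof.
move=> ne iT lT; rewrite !koszul_signU1 //.
have : enum_rank i != enum_rank l :> nat.
  by rewrite (inj_eq val_inj) (inj_eq enum_rank_inj).
by case: ltngtP => // _ _; rewrite /= ?expr0 ?expr1; ring.
Qed.

(** The terms cancel in pairs, which is valid in characteristic [2] as well. *)
Lemma sum_antisymmetric (P : rel X) (g : X -> X -> R) :
  symmetric P -> irreflexive P -> (forall i l, P i l -> g l i = - g i l) ->
  \sum_i \sum_(l | P i l) g i l = 0.
Proof.
move=> symP irrP anti.
pose lt i l := (enum_rank i < enum_rank l)%N.
have split_lt : \sum_i \sum_(l | P i l) g i l =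
    \sum_i \sum_(l | P i l && lt i l) g i l + \sum_i \sum_(l | P i l && lt l i) g i l.
  rewrite -big_split; apply: eq_bigr => i _; rewrite (bigID (lt i)) /=; congr (_ + _).
  apply: eq_bigl => l; case Pil: (P i l) => //=; rewrite /lt -leqNgt leq_eqVlt.
  case: eqP => // /val_inj/enum_rank_inj eq_li.
  by rewrite eq_li irrP in Pil.
rewrite {}split_lt [X in _ + X](exchange_big_dep predT) //= -big_split big1 // => i _.
rewrite /= [X in _ + X](eq_bigl (fun l => P i l && lt i l)) => [|l]; last by rewrite symP.
by rewrite -big_split big1 // => l /andP[Pil _] /=; rewrite (anti i l Pil) subrr.
Qed.

Lemma koszul_dd c z T : koszul_d c (koszul_d c z) T = 0.
Proof.
pose P i l := [&& i \notin T, l \notin T & i != l].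
pose g i l := koszul_sign i T * koszul_sign l (i |: T) * (c i * c l * z (l |: (i |: T))).
rewrite -[RHS](@sum_antisymmetric P g).
- rewrite /koszul_d big_mkcond; apply: eq_bigr => i _; rewrite /P.
  case: (boolP (i \in T)) => /= [_|iT]; first by rewrite big_pred0.
  rewrite mulr_sumr; apply: eq_big => l; last by rewrite /g => _; ring.
  by rewrite !inE negb_or andbC eq_sym.
- by move=> i l; rewrite /P andbCA eq_sym.
- by move=> i; rewrite /P eqxx !andbF.
- move=> i l /and3P[iT lT ne]; rewrite /g koszul_sign_swap // [l |: (i |: T)]setUCA.
  by ring.
Qed.

Lemma koszul_dB c z y T : koszul_d c (fun T => z T - y T) T = koszul_d c z T - koszul_d c y T.
Proof. by rewrite -sumrB; apply: eq_bigr => i _; rewrite mulrBr. Qed.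

Lemma koszul_dM c f z T : koszul_d c (fun T => f * z T) T = f * koszul_d c z T.
Proof. by rewrite mulr_sumr; apply: eq_bigr => i _; rewrite mulrCA. Qed.

Lemma koszul_d_ideal (I : R -> Prop) c z T :
  is_ideal I -> (forall T, I (z T)) -> I (koszul_d c z T).
Proof. by move=> idI Iz; apply: ideal_sum => // i _; apply: idealM. Qed.

Lemma koszul_s_ideal (I : R -> Prop) a z T :
  is_ideal I -> (forall T, I (z T)) -> I (koszul_s a z T).
Proof. by move=> idI Iz; apply: ideal_sum => // i _; apply: idealM. Qed.

(** Contraction and exterior multiplication anticommute up to the pairing of [a]
    with [c]: the terms that move an index [l] out and another index [i] in occur
    twice with opposite signs, and only those with [i = l] survive. *)
Lemma koszul_homotopy c a z T :
  koszul_d c (koszul_s a z) T + koszul_s a (koszul_d c z) T = (\sum_i a i * c i) * z T.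
Proof.
pose g i l := koszul_sign i T * koszul_sign l (i |: T) * (c i * a l * z ((i |: T) :\ l)).
have -> : koszul_d c (koszul_s a z) T =
    \sum_(i | i \notin T) a i * c i * z T + \sum_(i | i \notin T) \sum_(l in T) g i l.
  rewrite -big_split; apply: eq_bigr => i iT /=.
  rewrite /koszul_s big_setU1 //= mulrDr setU1K //; congr (_ + _); last first.
    by rewrite mulr_sumr; apply: eq_bigr => l _; rewrite /g; ring.
  have -> : koszul_sign i (i |: T) = koszul_sign i T by rewrite koszul_signU1 // ltnn mul1r.
  by rewrite -[RHS]mul1r -(koszul_sign_sqr i T); ring.
have -> : koszul_s a (koszul_d c z) T =
    \sum_(i in T) a i * c i * z T - \sum_(l in T) \sum_(i | i \notin T) g i l.
  rewrite -sumrB; apply: eq_bigr => l lT /=.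
  have notin_T1 : l \notin T :\ l by rewrite !inE eqxx.
  have sign_l : koszul_sign l (T :\ l) = koszul_sign l T.
    by rewrite -{2}(setD1K lT) koszul_signU1 // ltnn mul1r.
  rewrite /koszul_d (bigD1 l) //= mulrDr setD1K // sign_l; congr (_ + _).
    by rewrite -[RHS]mul1r -(koszul_sign_sqr l T); ring.
  rewrite mulr_sumr -sumrN; apply: eq_big => i.
    by rewrite !inE; case: eqP => [->|_]; rewrite ?lT ?andbF ?andbT.
  rewrite !inE => /andP[iT ne]; rewrite (negbTE ne) /= in iT.
  have niT1 : i \notin T :\ l by rewrite !inE (negbTE iT) andbF.
  rewrite /g; have -> : (i |: T) :\ l = i |: T :\ l.
    by apply/setP=> j; rewrite !inE; case: (j =P i) => [->|] //; rewrite ne.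
  have sign_r : koszul_sign l (i |: T) = koszul_sign l (i |: T :\ l).
    rewrite -{1}(setD1K lT) setUCA koszul_signU1 ?ltnn ?mul1r //.
    by rewrite !inE eqxx eq_sym (negbTE ne).
  have := koszul_sign_swap ne niT1 notin_T1.
  rewrite setD1K // sign_l sign_r => swap.
  have -> : koszul_sign l T * a l * (koszul_sign i (T :\ l) * c i * z (i |: T :\ l)) =
      (koszul_sign l T * koszul_sign i T) *
      (koszul_sign i T * koszul_sign i (T :\ l) * (c i * a l * z (i |: T :\ l))).
    by rewrite -[LHS]mul1r -(koszul_sign_sqr i T); ring.
  rewrite swap -[RHS]mul1r -(koszul_sign_sqr i (T :\ l)).
  by ring.
rewrite [X in _ - X]exchange_big /= addrACA subrr addr0.
by rewrite mulr_suml [RHS](bigID [in T]) /= addrC.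
Qed.

Definition koszul_degree j z : Prop := forall T, #|T| != j -> z T = 0.

(** Multiplication by a combination [f] of the [x i] is null-homotopic, so a cycle
    [z] gives the cycle [koszul_s a z] modulo [f], one degree higher. There it is
    a boundary by induction, and [f], being a nonzerodivisor, can be cancelled.
    In degrees above the number of variables there is nothing to prove. *)
Lemma koszul_exact x (I : R -> Prop) fs j z :
  is_ideal I -> weakly_regular I fs ->
  (forall f, f \in fs -> exists a, f = \sum_i a i * x i) ->
  koszul_degree j z -> (#|X| < j + size fs)%N ->
  (forall T, I (koszul_d x z T)) ->
  exists y, forall T, I (z T - koszul_d x y T).
Proof.
elim: fs I j z => [|f fs IH] I j z idI.
  move=> _ _ deg_z; rewrite addn0 => lt_j _; exists (fun=> 0) => T.
  rewrite deg_z; last by rewrite ltn_eqF // (leq_ltn_trans _ lt_j) ?max_card.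
  rewrite /koszul_d big1 ?subr0 => [|i _]; last by rewrite mulr0.
  exact: ideal0.
move=> [reg_f reg_fs] fs_x deg_z lt_j dz.
have [a def_f] := fs_x f (mem_head _ _).
have homotopy T : koszul_d x (koszul_s a z) T = f * z T - koszul_s a (koszul_d x z) T.
  by rewrite def_f -(koszul_homotopy x) addrK.
have idIf := add_ideal_is_ideal idI f.
have [||||y Hy] := IH (add_ideal I f) j.+1 (koszul_s a z) idIf reg_fs.
- by move=> g fs_g; apply: fs_x; rewrite inE fs_g orbT.
- move=> T card_T; apply: big1 => i iT; rewrite deg_z ?mulr0 //.
  by apply: contraNneq card_T => <-; rewrite [#|T|](cardsD1 i) iT.
- by rewrite addSnnS.
- move=> T; rewrite homotopy; apply: (idealB idIf).
    by rewrite mulrC; apply: (idealM idIf); apply: add_ideal_gen.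
  by apply: (koszul_s_ideal _ _ idIf) => T'; apply: sub_add_ideal.
have [w Hw] := choice Hy.
exists w => T; apply: reg_f.
have := koszul_d_ideal x T idI Hw.
have -> : koszul_d x (fun T => koszul_s a z T - koszul_d x y T - f * w T) T =
    koszul_d x (koszul_s a z) T - f * koszul_d x w T.
  by rewrite !koszul_dB koszul_dd subr0 koszul_dM.
rewrite homotopy => Id.
have -> : f * (z T - koszul_d x w T) =
  (f * z T - koszul_s a (koszul_d x z) T - f * koszul_d x w T) +
  koszul_s a (koszul_d x z) T by ring.
by apply: idealD => //; apply: koszul_s_ideal.
Qed.

End Koszul.

(** * Upper bounds on the length of a regular sequence *)

Section UpperBound.
Variables (K : fieldType) (X : finType).
Local Notation R := {mpoly K[#|X|]}.
Implicit Types (Sigma : {set {set X}}) (A C F G Q T : {set X}) (fs : seq R).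

Let x (i : X) : R := xmon K [set i].

Lemma msetB A C : A \subset C -> (mset C - mset A)%MM = mset (C :\: A).
Proof.
move=> /subsetP AC; apply/mnmP=> i; rewrite mnmBE !mnmE inE.
by case: (boolP (_ \in A)) => [/AC ->|] //; rewrite subn0.
Qed.

Lemma mcoeff_koszul_sign i T (f : R) m :
  (koszul_sign R i T * f)@_m = koszul_sign K i T * f@_m.
Proof.
rewrite /koszul_sign -signr_odd -[in RHS]signr_odd.
by case: (odd _); rewrite ?expr1 ?expr0 ?mulN1r ?mul1r ?mcoeffN.
Qed.

Lemma koszul_sign_neq0 i T : koszul_sign K i T != 0.
Proof. by rewrite signr_eq0. Qed.

Lemma mcoeff_koszul_d (z : {set X} -> R) T C :
  (koszul_d x z T)@_(mset C) =
  \sum_(i in C :\: T) koszul_sign K i T * (z (i |: T))@_(mset (C :\ i)).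
Proof.
rewrite raddf_sum big_mkcond [RHS]big_mkcond; apply: eq_bigr => i _ /=.
rewrite inE; case: (i \in T) => //=; rewrite -mulrA mcoeff_koszul_sign mcoeff_xmonM.
rewrite msupport_mset sub1set; case: (boolP (i \in C)) => iC; last exact: mulr0.
by rewrite msetB // sub1set.
Qed.

(** The monomial of a face [F] of top dimension, placed on the complement of [F],
    is a Koszul cycle. It is not a boundary when [F] lies on the boundary of a
    missing simplex [C]: applying the differential once more isolates the monomial
    of [C], whose proper divisors all survive modulo the ideal. *)
Lemma regular_length_missing_face Sigma C kap fs :
  simplicial Sigma -> (forall F, F \in Sigma -> #|F| <= kap)%N ->
  #|C| = kap.+1 -> (forall i, i \in C -> C :\ i \in Sigma) ->
  (forall f, f \in fs -> exists a, f = \sum_i a i * x i) ->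
  weakly_regular (SR_ideal Sigma) fs -> (size fs <= kap)%N.
Proof.
move=> simp le_kap card_C bdC fs_x reg; rewrite leqNgt; apply/negP=> lt_kap.
have idI := SR_ideal_is_ideal K simp.
have [b bC] : exists b, b \in C by apply/set0Pn; rewrite -card_gt0 card_C.
set F := C :\ b; have card_F : #|F| = kap.
  by move: card_C; rewrite (cardsD1 b) bC add1n => -[].
pose z T : R := if T == ~: F then xmon K F else 0.
have dz T : SR_ideal Sigma (koszul_d x z T).
  apply: ideal_sum => // i iT; rewrite /z; case: eqP => [eqF|_]; last first.
    by rewrite mulr0; apply: ideal0.
  have iF : i \notin F by rewrite -in_setC -eqF setU11.
  rewrite -mulrA; apply: (idealM idI); rewrite /x xmonM ?disjoints1 //.
  by apply: SR_ideal_xmon; apply/negP=> /le_kap; rewrite cardsU1 iF card_F ltnn.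
have [||y Hy] := koszul_exact (j := #|~: F|) (z := z) idI reg fs_x _ _ dz.
- by move=> T; rewrite /z; case: (T =P ~: F) => // ->; rewrite eqxx.
- by move: (cardsC F) lt_kap; rewrite card_F; move: (size fs) => s; lia.
(* Both sides are compared on the monomial of [C]; on the complement of [C] the
   differential of [z] has [b] as its only surviving index. *)
have := koszul_dB x z (koszul_d x y) (~: C).
rewrite koszul_dd subr0 => /(congr1 (mcoeff (mset C))).
rewrite !mcoeff_koszul_d big1 => [|i]; last first.
  rewrite !inE negbK => /andP[_ iC].
  by rewrite Hy ?mulr0 // msupport_mset bdC.
rewrite (bigD1 b) /=; last by rewrite !inE negbK bC.
rewrite big1 ?addr0 => [|i /andP[]]; last first.
  rewrite !inE negbK => /andP[_ iC] ne.
  rewrite /z ifN ?mcoeff0 ?mulr0 //; apply/negP=> /eqP/setP/(_ i).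
  by rewrite !inE eqxx /= iC ne.
rewrite /z ifT; last by rewrite /F setCD setUC.
rewrite mcoeff_xmon eqxx mulr1 => /esym/eqP.
by rewrite (negbTE (koszul_sign_neq0 _ _)).
Qed.

(** Let no edge join [A] to the vertices outside [A :|: Q]. The part over [A] of
    the differential of the top element on the complement of [Q] is then a
    Koszul cycle. Were it a boundary, the constant term of the bounding chain
    would be nonzero because of [a], and zero because of [b]. *)
Lemma regular_length_separator Sigma A Q a b fs :
  simplicial Sigma -> [disjoint A & Q] ->
  a \in A -> [set a] \in Sigma -> b \notin A :|: Q -> [set b] \in Sigma ->
  (forall u v, u \notin A :|: Q -> v \in A -> [set u; v] \notin Sigma) ->
  (forall f, f \in fs -> exists a, f = \sum_i a i * x i) ->
  weakly_regular (SR_ideal Sigma) fs -> (size fs <= #|Q|.+1)%N.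
Proof.
move=> simp dAQ aA aS bAQ bS sep fs_x reg; rewrite leqNgt; apply/negP=> lt_Q.
have idI := SR_ideal_is_ideal K simp.
set W := ~: Q.
have aW : a \in W by rewrite inE (disjointFr dAQ).
have [bA bW] : b \notin A /\ b \in W.
  by apply/andP; move: bAQ; rewrite !inE negb_or.
pose e T : R := (T == W)%:R.
pose alpha i : R := if i \in A then x i else 0.
pose z := koszul_d alpha e.
have deg_z : koszul_degree #|W|.-1 z.
  move=> T card_T; apply: big1 => i iT; rewrite /e; case: eqP => [eqW|_]; last exact: mulr0.
  by rewrite -eqW cardsU1 iT eqxx in card_T.
have dz T : SR_ideal Sigma (koszul_d x z T).
  (* Subtracting the square of the part over [A] leaves the terms x_i x_l with [l] in
     [A] and [i] outside [A :|: Q], which are no edges. *)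
  rewrite -[koszul_d x z T]subr0 -[X in _ - X](koszul_dd alpha e T) -sumrB.
  apply: ideal_sum => // i iT; rewrite -mulrBl -mulrBr mulr_sumr.
  apply: ideal_sum => // l liT; rewrite /e; case: eqP => [eqW|_]; last first.
    by rewrite !mulr0; apply: ideal0.
  have iW : i \in W by rewrite -eqW !inE eqxx orbT.
  rewrite /alpha; case: (boolP (i \in A)) => iA.
    by rewrite subrr mulr0 mul0r; apply: ideal0.
  case: (boolP (l \in A)) => lA; last by rewrite mulr0 mul0r mulr0; apply: ideal0.
  have -> : koszul_sign R i T * (x i - 0) * (koszul_sign R l (i |: T) * x l * 1%:R) =
    koszul_sign R i T * koszul_sign R l (i |: T) * (x i * x l) by ring.
  apply: (idealM idI); rewrite /x xmonM.
    by apply: SR_ideal_xmon; apply: sep => //; rewrite inE (negbTE iA) -in_setC.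
  by rewrite disjoints1 inE; apply: contraNneq iA => ->.
have [|y Hy] := koszul_exact (j := #|W|.-1) (z := z) idI reg fs_x deg_z _ dz.
- have : (0 < #|W|)%N by apply/card_gt0P; exists a.
  by move: (cardsC Q) lt_Q; rewrite -/W; move: (size fs) => s; lia.
have dy v : v \in W ->
    (koszul_d x y (W :\ v))@_(mset [set v]) = koszul_sign K v (W :\ v) * (y W)@_0%MM.
  move=> vW; rewrite mcoeff_koszul_d.
  have -> : [set v] :\: (W :\ v) = [set v].
    by apply/setP=> i; rewrite !inE; case: (i == v); rewrite ?andbF.
  by rewrite big_set1 setD1K // setDv mset0.
have coeff v : v \in W -> [set v] \in Sigma ->
    (z (W :\ v))@_(mset [set v]) = koszul_sign K v (W :\ v) * (y W)@_0%MM.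
  move=> vW vS; apply/eqP; rewrite -dy // -subr_eq0 -mcoeffB; apply/eqP.
  by apply: Hy; rewrite msupport_mset.
have zE v : v \in W -> z (W :\ v) = koszul_sign R v (W :\ v) * alpha v.
  move=> vW; rewrite /z /koszul_d (bigD1 v) ?inE ?eqxx //= setD1K // /e eqxx mulr1.
  rewrite big1 ?addr0 // => i /andP[_ ne]; case: eqP => [/setP/(_ v)|_]; last exact: mulr0.
  by rewrite !inE eqxx eq_sym (negbTE ne) -in_setC vW.
have yW0 : (y W)@_0%MM = 0.
  have := coeff b bW bS; rewrite zE // /alpha (negbTE bA) mulr0 mcoeff0 => /esym/eqP.
  by rewrite mulf_eq0 (negbTE (koszul_sign_neq0 _ _)) => /eqP.
have := coeff a aW aS; rewrite zE // /alpha aA yW0 mulr0 mcoeff_koszul_sign.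
rewrite mcoeff_xmon eqxx mulr1 => /eqP.
by rewrite (negbTE (koszul_sign_neq0 _ _)).
Qed.

End UpperBound.

(** * The quotient module in terms of the ideal *)

Section QuotientModule.
Variables (R : comNzRingType) (T : finType) (P : pred T) (g : T -> R).
Local Notation M := (quot_gen P g).
Implicit Types (f u v : R) (fs : seq R).

Local Open Scope quotient_scope.

Definition quot_pi u : M := \pi_({ideal_quot (ideal_gen P g)}) u.

Let I u : Prop := u \in ideal_gen P g.

Lemma quot_pi_surj (x : M) : exists u, x = quot_pi u.
Proof. exact: quot_genP. Qed.

Lemma quot_piD u v : quot_pi (u + v) = quot_pi u + quot_pi v.
Proof. exact: quot_genD. Qed.

Lemma quot_piZ a u : quot_pi (a * u) = a *: quot_pi u.
Proof. by rewrite [RHS]quot_scale_pi. Qed.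

Lemma quot_piBM u a v : quot_pi (u - a * v) = quot_pi u - a *: quot_pi v.
Proof. by rewrite quot_piD -mulNr quot_piZ scaleNr. Qed.

Lemma quot_pi_eq u v : quot_pi u = quot_pi v <-> I (u - v).
Proof.
rewrite /I Quotient.idealrBE; split=> [uv|/eqP //].
by apply/eqP.
Qed.

Lemma quot_pi_eq0 u : quot_pi u = 0 <-> I u.
Proof.
have <- : quot_pi 0 = 0 by rewrite -(mul0r 0) quot_piZ scale0r.
by rewrite quot_pi_eq subr0.
Qed.

Lemma in_span_nil (x : M) : in_span [::] x <-> x = 0.
Proof. by split=> [[v ->]|->]; [|exists (fun=> 0)]; rewrite big_ord0. Qed.

Lemma in_span_rcons fs f (x : M) :
  in_span (rcons fs f) x <-> exists y, in_span fs (x - f *: y).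
Proof.
split=> [[v ->]|[y [v def_x]]].
  exists (v (size fs)); exists v; rewrite size_rcons big_ord_recr /=.
  rewrite nth_rcons ltnn eqxx addrK; apply: eq_bigr => i _.
  by rewrite nth_rcons ltn_ord.
exists (fun i => if i == size fs then y else v i).
rewrite size_rcons big_ord_recr /= nth_rcons ltnn !eqxx.
apply/esym; rewrite -(subrK (f *: y) x) def_x; congr (_ + _).
by apply: eq_bigr => i _; rewrite nth_rcons ltn_ord ltn_eqF.
Qed.

Lemma in_span_pi fs u : in_span fs (quot_pi u) <-> foldl (@add_ideal R) I fs u.
Proof.
elim/last_ind: fs u => [|fs f IH] u.
  by rewrite in_span_nil quot_pi_eq0.
rewrite in_span_rcons foldl_rcons; split=> [[y]|[w Iw]].
  have [w ->] := quot_pi_surj y; rewrite -quot_piBM => /IH Iuw.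
  by exists w.
by exists (quot_pi w); rewrite -quot_piBM; apply/IH.
Qed.

(** The last clause of a regular sequence, that the quotient be nonzero, is kept as
    a separate condition. *)
Lemma regular_seq_quot fs : regular_seq M fs <->
  weakly_regular I fs /\ exists u, ~ foldl (@add_ideal R) I fs u.
Proof.
rewrite /regular_seq weakly_regularP.
have in_spanP f u i : in_span (take i fs) (f *: quot_pi u) <->
    foldl (@add_ideal R) I (take i fs) (f * u).
  by rewrite -quot_piZ in_span_pi.
split=> -[reg [u nu]]; split.
- by move=> i lt_i v /in_spanP /(reg i lt_i) /in_span_pi.
- by have [w def_u] := quot_pi_surj u; exists w => Iw; apply: nu; rewrite def_u in_span_pi.
- move=> i lt_i x; have [v ->] := quot_pi_surj x.
  by move=> /in_spanP /(reg i lt_i) /in_span_pi.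
- by exists (quot_pi u); rewrite in_span_pi.
Qed.

Lemma annihilator_quot a : (a \in annihilator M) = (a \in ideal_gen P g).
Proof.
apply/asboolP/idP => [ann|Ia x].
  by apply/quot_pi_eq0; rewrite -[a]mulr1 quot_piZ ann.
have [u ->] := quot_pi_surj x; rewrite -quot_piZ; apply/quot_pi_eq0.
by rewrite /I mulrC; apply: ideal_genM.
Qed.

Lemma associated_prime_quot Q : associated_prime M Q <->
  prime_ideal Q /\ exists u, forall a, (a \in Q) = (a * u \in ideal_gen P g).
Proof.
have eqM a u : (a *: quot_pi u == 0) = (a * u \in ideal_gen P g).
  by rewrite -quot_piZ; apply/eqP/idP => /quot_pi_eq0.
split=> -[primeQ [x annQ]]; split=> //.
  have [u def_x] := quot_pi_surj x.
  by exists u => a; rewrite annQ def_x eqM.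
by exists (quot_pi x) => a; rewrite annQ eqM.
Qed.

End QuotientModule.

(** * Krull dimension of coordinate subspaces *)

Section KrullDimension.
Variables (K : fieldType) (X : finType).
Local Notation R := {mpoly K[#|X|]}.
Implicit Types (Sigma : {set {set X}}) (F G : {set X}) (f g h : R).
Implicit Types (P Q : {pred R}).

(** The ideal of the coordinate subspace spanned by [F], generated by the variables
    outside [F]. *)
Definition face_prime F : {pred R} :=
  fun f => `[< SR_ideal (powerset F) f >].

Lemma face_primeP F f : reflect (SR_ideal (powerset F) f) (f \in face_prime F).
Proof. exact: asboolP. Qed.

Lemma face_prime_sub F G : F \subset G -> {subset face_prime G <= face_prime F}.
Proof.
move=> FG f /face_primeP Gf; apply/face_primeP; apply: SR_ideal_sub Gf => A.
by rewrite !powersetE => /subset_trans; apply.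
Qed.

Lemma face_prime_xmon F G : (xmon K G \in face_prime F) = ~~ (G \subset F).
Proof.
apply/face_primeP/idP => [/(_ (mset G))|nGF].
  rewrite powersetE msupport_mset mcoeff_xmon eqxx => xG.
  by apply/negP=> /xG/eqP; rewrite oner_eq0.
by apply: SR_ideal_xmon; rewrite powersetE.
Qed.

Lemma truncate_to_face F f :
  exists g, forall m, g@_m = if msupport m \subset F then f@_m else 0.
Proof.
exists (\sum_(m <- msupp f | msupport m \subset F) f@_m *: 'X_[m]) => m.
exact: mcoeff_filter.
Qed.

Lemma face_prime_is_ideal F : is_ideal (SR_ideal (K := K) (powerset F)).
Proof. exact/SR_ideal_is_ideal/simplicial_powerset. Qed.

(** Polynomials can be truncated to the monomials supported in [F] without changing
    their class, and the truncations multiply without zero divisors. *)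
Lemma prime_face_prime F : prime_ideal (face_prime F).
Proof.
have idF := face_prime_is_ideal F.
split; first split.
- exact/face_primeP/(ideal0 idF).
- rewrite (_ : 1 = xmon K set0); last by rewrite /xmon mset0 mpolyX0.
  by rewrite face_prime_xmon sub0set.
- by move=> a u v /face_primeP Fu /face_primeP Fv; apply/face_primeP/idF.2.
move=> f g /face_primeP Ffg.
have [f1 Hf1] := truncate_to_face F f; have [g1 Hg1] := truncate_to_face F g.
have trunc_mod h h1 : (forall m, h1@_m = if msupport m \subset F then h@_m else 0) ->
    SR_ideal (powerset F) (h - h1).
  by move=> Hh m; rewrite powersetE mcoeffB Hh => ->; rewrite subrr.
have Ff1g1 : SR_ideal (powerset F) (f1 * g1).
  have -> : f1 * g1 = f * g - (g * (f - f1) + f1 * (g - g1)) by ring.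
  apply: (idealB idF) => //; apply: (idealD idF); apply: (idealM idF); exact: trunc_mod.
have : f1 * g1 = 0.
  apply/mpolyP=> m; rewrite mcoeff0.
  case: (boolP (msupport m \subset F)) => [mF|nmF]; first by apply: Ff1g1; rewrite powersetE.
  rewrite mcoeffM big1 // => k /eqP/(congr1 (@msupport X)); rewrite msupportD => def_m.
  rewrite Hf1 Hg1; move: nmF; rewrite def_m subUset negb_and.
  by case/orP=> /negbTE ->; rewrite ?mul0r ?mulr0.
move/eqP; rewrite mulf_eq0 => /orP[] /eqP eq0; apply/orP; [left|right];
  apply/face_primeP; move=> m; rewrite powersetE => mF.
  by have := Hf1 m; rewrite mF eq0 mcoeff0.
by have := Hg1 m; rewrite mF eq0 mcoeff0.
Qed.

(** Remove the vertices of [F] one by one. *)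
Lemma face_prime_chain F (I : {pred R}) :
  {subset I <= face_prime F} -> exists P : nat -> {pred R}, prime_chain I #|F| P.
Proof.
move=> IF; pose G i := [set x in drop i (enum F)].
exists (fun i => face_prime (G i)); split=> [||i lt_i].
- suff -> : G 0 = F by [].
  by apply/setP=> x; rewrite inE drop0 mem_enum.
- by move=> i _; apply: prime_face_prime.
have lt_ie : (i < size (enum F))%N by rewrite -cardE.
have [x0 _] : exists x, x \in F by apply/card_gt0P; apply: leq_ltn_trans lt_i.
have def_drop := drop_nth x0 lt_ie.
split.
  by apply: face_prime_sub; apply/subsetP=> x; rewrite !inE def_drop inE orbC => ->.
set x := nth x0 (enum F) i in def_drop => sub.
have := sub (xmon K [set x]); rewrite !face_prime_xmon !sub1set !inE def_drop mem_head.
have := drop_uniq i (enum_uniq F); rewrite def_drop /= => /andP[/negbTE -> _].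
by move=> /(_ isT).
Qed.

Definition independent_mod P (T : finType) (b : T -> R) : Prop :=
  forall lam : T -> K, \sum_t lam t *: b t \in P -> forall t, lam t = 0.

Lemma msizeX_le f j : (msize (f ^+ j) <= j * (msize f).+1 + 1)%N.
Proof.
elim: j => [|j IH]; first by rewrite expr0 msize1.
by rewrite exprS; have := msizeM_le f (f ^+ j); lia.
Qed.

Section IndependentPowers.
Variables (P Q : {pred R}) (f : R).
Hypotheses (idealP : prime_ideal P) (idealQ : prime_ideal Q).
Hypotheses (PQ : {subset P <= Q}) (Qf : f \in Q) (Pf : f \notin P).

Lemma powers_independent n (h : nat -> R) : (forall j, h j \in Q -> h j = 0) ->
  \sum_(j < n) f ^+ j * h j \in P -> forall j, (j < n)%N -> h j = 0.
Proof.
have [[_ _ closeQ] _] := idealQ; have [_ primeP] := idealP.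
elim: n h => // n IH h h0; rewrite big_ord_recl expr0 mul1r.
have -> : \sum_(i < n) f ^+ lift ord0 i * h (lift ord0 i) =
    f * \sum_(i < n) f ^+ i * h i.+1.
  by rewrite mulr_sumr; apply: eq_bigr => i _; rewrite mulrA -exprS.
set s := \sum_(i < n) _ => Phs.
have h00 : h 0%N = 0.
  apply: h0; have -> : h 0%N = - s * f + (h 0%N + f * s) by ring.
  by apply: closeQ => //; apply: PQ.
move: Phs; rewrite h00 add0r => /primeP; rewrite (negbTE Pf) => Ps [|j] // lt_j.
by apply: (IH (fun j => h j.+1)) => // i; apply: h0.
Qed.

Lemma independent_mod_powers L (T : finType) (b : T -> R) : independent_mod Q b ->
  independent_mod P (fun u : 'I_L * T => f ^+ u.1 * b u.2).
Proof.
have [[Q0 _ _] _] := idealQ.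
move=> ind lam.
have -> : \sum_u lam u *: (f ^+ u.1 * b u.2) =
    \sum_(j < L) \sum_t lam (j, t) *: (f ^+ j * b t).
  by rewrite pair_bigA; apply: eq_bigr => -[].
pose h j := if insub j is Some j' then \sum_t lam (j', t) *: b t else 0 : R.
have hE (j : 'I_L) : h j = \sum_t lam (j, t) *: b t by rewrite /h valK.
have -> : \sum_(j < L) \sum_t lam (j, t) *: (f ^+ j * b t) = \sum_(j < L) f ^+ j * h j.
  apply: eq_bigr => j _; rewrite hE mulr_sumr.
  by apply: eq_bigr => t _; rewrite scalerAr.
have h0 j : h j \in Q -> h j = 0.
  rewrite /h; case: insubP => // j' _ _ /ind lam0.
  by apply: big1 => t _; rewrite lam0 scale0r.
move=> /(powers_independent h0) {}h0 [j t].
by apply: (ind (fun t => lam (j, t))); rewrite -hE h0.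
Qed.

End IndependentPowers.

(** Choosing [f] in each prime of the chain and not in the previous one makes the
    monomials in these elements linearly independent: reduce a relation modulo the
    next prime, then divide by [f]. *)
Lemma prime_chain_independent n (P : nat -> {pred R}) :
  (forall i, (i <= n)%N -> prime_ideal (P i)) ->
  (forall i, (i < n)%N -> {subset P i <= P i.+1} /\ ~ {subset P i.+1 <= P i}) ->
  exists c, forall L, exists (T : finType) (b : T -> R),
    [/\ #|T| = (L.+1 ^ n)%N, independent_mod (P 0%N) b &
        forall t, (msize (b t) <= L.+1 * c.+1)%N].
Proof.
elim: n P => [|n IH] P primeP chainP.
  exists 0%N => L; exists unit, (fun=> 1); split=> [||_].
  - by rewrite card_unit expn0.
  - have [[_ P1 closeP] _] := primeP 0%N isT.
    move=> lam; rewrite (big_pred1 tt) => [Plam []|[]//].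
    apply: contraNeq P1 => lam0; rewrite -(scalerK lam0 1) -mul_mpolyC.
    by rewrite -[_ * _]addr0; apply: closeP => //; case: (primeP 0%N isT) => -[].
  - by rewrite msize1; lia.
have [c IHc] := IH (fun i => P i.+1) (fun i => primeP i.+1) (fun i => chainP i.+1).
have [sub nsub] := chainP 0%N isT.
have [f fP1 fP0] : exists2 f, f \in P 1%N & f \notin P 0%N.
  apply: contrapT => nex; apply: nsub => f fP1; apply: contrapT => /negP fP0.
  by apply: nex; exists f.
(* The degree of [f] plus [2]: one unit for each use of the bound
   [msize (p * q) <= (msize p + msize q).+1]. *)
exists (c + (msize f).+2)%N => L; have [T [b [card_T ind_b size_b]]] := IHc L.
exists ('I_L.+1 * T)%type, (fun u : 'I_L.+1 * T => f ^+ u.1 * b u.2); split.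
- by rewrite card_prod card_ord card_T expnS.
- by apply: independent_mod_powers ind_b => //; apply: primeP.
- move=> [j t] /=; have := msizeM_le (f ^+ j) (b t).
  have := msizeX_le f j; have := size_b t; have := ltn_ord j.
  move: (msize (f ^+ j * b t)) (msize (f ^+ j)) (msize (b t)) (msize f) => r p q s.
  move: (nat_of_ord j) => k lt_k le_q le_p le_r.
  have le_ks : (k * s.+1 <= L * s.+1)%N by rewrite leq_mul2r -ltnS lt_k orbT.
  have -> : (L.+1 * (c + s.+2).+1 = L * s.+1 + L + s.+2 + L.+1 * c.+1)%N by ring.
  by lia.
Qed.

(** There are only [D.+1 ^ #|F|] monomials supported in [F] with exponents at most
    [D], so the coefficient vectors of more polynomials than that are dependent. *)
Lemma dependent_on_face F D (T : finType) (b : T -> R) :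
  (D.+1 ^ #|F| < #|T|)%N -> (forall t, msize (b t) <= D.+1)%N ->
  exists lam : T -> K, SR_ideal (powerset F) (\sum_t lam t *: b t) /\
    exists t, lam t != 0.
Proof.
move=> lt_T size_b; pose C := {ffun {x | x \in F} -> 'I_D.+1}.
pose mon (c : C) : 'X_{1..#|X|} :=
  [multinom if insub (enum_val i) is Some y then nat_of_ord (c y) else 0%N | i < #|X|].
have card_C : #|C| = (D.+1 ^ #|F|)%N.
  by rewrite card_ffun card_ord card_sig; congr (_ ^ _)%N; apply: eq_card.
pose A := \matrix_(i < #|T|, j < #|C|) (b (enum_val i))@_(mon (enum_val j)).
have [v /sub_kermxP vA0 v0] : exists2 v : 'rV_#|T|, (v <= kermx A)%MS & v != 0.
  apply/rowV0Pn; rewrite kermx_eq0 /row_free neq_ltn.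
  by rewrite (leq_ltn_trans (rank_leq_col A)) // card_C.
exists (fun t => v 0 (enum_rank t)); split; last first.
  have [j vj] : exists j, v 0 j != 0.
    apply: contrapT => nex; case/eqP: v0; apply/rowP=> j; rewrite mxE.
    by apply: contrapT => vj; apply: nex; exists j; apply/eqP.
  by exists (enum_val j); rewrite enum_valK.
move=> m; rewrite powersetE => mF; rewrite raddf_sum /=.
case: (boolP [forall i, m i <= D]%N) => [/forallP le_D|/forallPn[i lt_D]]; last first.
  rewrite big1 // => t _; rewrite mcoeffZ [_@_m]memN_msupp_eq0 ?mulr0 //.
  apply: msize_mdeg_ge; apply: leq_trans (size_b t) _.
  rewrite mdegE (bigD1 i) //=; move: lt_D; rewrite -ltnNge => /leq_trans; apply.
  exact: leq_addr.
pose c : C := [ffun y => inord (m (enum_rank (val y)))].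
have def_m : m = mon c.
  apply/mnmP=> i; rewrite mnmE; case: insubP => [y _ def_y|niF].
    by rewrite ffunE inordK ?ltnS // def_y enum_valK.
  apply/eqP; apply: contraNT niF => mi; apply: (subsetP mF).
  by rewrite inE enum_valK.
have := congr1 (fun B : 'rV_#|C| => B 0 (enum_rank c)) vA0; rewrite !mxE => vAc.
rewrite -[RHS]vAc (reindex _ (onW_bij _ (@enum_val_bij T))) /=.
by apply: eq_bigr => i _; rewrite mcoeffZ enum_valK mxE enum_rankK -def_m.
Qed.

(** Take for [F] the vertices whose variable is not in [P]; as [P] is prime, it does
    not contain their product either. *)
Lemma prime_contains_face P : prime_ideal P ->
  exists F, {subset face_prime F <= P} /\ xmon K F \notin P.
Proof.
move=> [[P0 P1 closeP] primeP]; have idP : is_ideal (fun u => u \in P).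
  by split=> // a u v; apply: closeP.
exists [set x | xmon K [set x] \notin P]; split=> [f /face_primeP Ff|].
  rewrite (mpolyE f) big_seq; apply: (ideal_sum idP) => m mf.
  have /subsetPn[x xm] : ~~ (msupport m \subset [set x | xmon K [set x] \notin P]).
    by apply/negP=> sub; rewrite mcoeff_msupp Ff ?powersetE ?eqxx in mf.
  rewrite inE negbK => Px.
  have le : (mset [set x] <= m)%MM by rewrite mset_le sub1set.
  rewrite -(submK le) mpolyXD scalerAl; exact: (idealM idP).
rewrite -prod_varX; elim/big_ind: _ => // [u v Pu Pv|x].
  by apply/negP=> /primeP; rewrite (negbTE Pu) (negbTE Pv).
by rewrite inE varXE.
Qed.

(** The first prime of the chain contains the prime of some [F] whose monomial is not
    in [I]; a chain longer than [#|F|] would give more independent polynomials than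
    there is room for on [F]. *)
Lemma prime_chain_bound (I : {pred R}) d n (P : nat -> {pred R}) :
  (forall F, xmon K F \notin I -> #|F| <= d)%N ->
  prime_chain I n P -> (n <= d)%N.
Proof.
move=> face_le [IP primeP chainP].
have [F [FP nFP]] := prime_contains_face (primeP 0%N isT).
apply: (@leq_trans #|F|); last by apply: face_le; apply: contra nFP; apply: IP.
have [c Hc] := prime_chain_independent primeP chainP.
(* With this [L], already [L.+1 ^ #|F|.+1] exceeds the number
   [(L.+1 * c.+1) ^ #|F|] of available monomials. *)
have [T [b [card_T ind_b size_b]]] := Hc (c.+1 ^ #|F|)%N.
set L := (c.+1 ^ #|F|)%N in card_T size_b.
rewrite leqNgt; apply/negP=> lt_n.
have [||lam [Flam [t lam_t]]] := @dependent_on_face F (L.+1 * c.+1).-1 T b.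
- rewrite card_T prednK ?muln_gt0 // expnMn mulnC -/L.
  apply: (@leq_trans (L.+1 ^ #|F|.+1)); last exact: leq_pexp2l.
  by rewrite expnS ltn_pmul2r ?expn_gt0.
- by move=> t; rewrite prednK ?muln_gt0.
by case/eqP: lam_t; apply: ind_b; apply: FP; apply/face_primeP.
Qed.

Lemma is_quot_dim_face (I : {pred R}) F :
  {subset I <= face_prime F} ->
  (forall G, xmon K G \notin I -> #|G| <= #|F|)%N -> is_quot_dim I #|F|.
Proof.
move=> IF face_le; split; first exact: face_prime_chain.
by move=> m P; apply: prime_chain_bound.
Qed.

End KrullDimension.

(** * Leaf orders and separators *)

Lemma seq_min_le (s : seq nat) n : n \in s -> (seq_min s <= n)%N.
Proof.
rewrite /seq_min; elim: s (head _ _) => // a s IH z; rewrite inE big_cons.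
by case/orP => [/eqP ->|/(IH z) le_n]; rewrite geq_min ?leqnn // le_n orbT.
Qed.

Lemma seq_min_mem (s : seq nat) : s != [::] -> seq_min s \in s.
Proof.
case: s => // a s _; rewrite /seq_min.
suff mem_min z r : \big[minn/z]_(n <- r) n \in z :: r.
  by have := mem_min a (a :: s); rewrite !inE orbA orbb.
elim: r => [|b r IH]; first by rewrite big_nil mem_head.
rewrite big_cons; case: leqP => _; first by rewrite !inE eqxx orbT.
by move: IH; rewrite !inE => /orP[] ->; rewrite ?orbT.
Qed.

Section LeafOrder.
Variables (X : finType) (Delta : {set {set X}}) (S : seq {set X}).
Implicit Types (F G : {set X}) (i j m p : nat).
Hypotheses (simp : simplicial Delta) (leafS : leaf_order Delta S) (S_gt1 : (1 < size S)%N).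

Local Notation facet := (nth set0 S).

Lemma facet_in F : F \in S = maxset (fun G => G \in Delta) F.
Proof. by case: leafS => _ -> _; rewrite inE. Qed.

Lemma mem_complex F : (F \in Delta) = has (fun G => F \subset G) S.
Proof.
apply/idP/hasP => [FD|[G SG FG]].
  have [G maxG FG] := maxset_exists (P := fun G => G \in Delta) FD.
  by exists G; rewrite ?facet_in.
by apply: simp FG _; move: SG; rewrite facet_in => /maxsetp.
Qed.

Lemma facet_sub i j : (i < size S)%N -> (j < size S)%N ->
  facet i \subset facet j -> i = j.
Proof.
move=> lt_i lt_j sub; have [uniqS _ _] := leafS.
have /maxsetP[_ max_i] : maxset (fun G => G \in Delta) (facet i).
  by rewrite -facet_in mem_nth.
apply/eqP; rewrite -(nth_uniq set0 lt_i lt_j uniqS) eq_sym; apply/eqP/max_i => //.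
by have := mem_nth set0 lt_j; rewrite facet_in => /maxsetp.
Qed.

Lemma separator_parent m : (0 < m < size S)%N ->
  exists2 p, (p < m)%N & forall i, (i < m)%N -> facet m :&: facet i \subset facet p.
Proof.
have [_ _ leaf] := leafS; move=> /leaf[p lt_p sub]; exists p => // i /sub.
by move/subset_trans; apply; apply: subsetIr.
Qed.

Lemma separator_sub m p :
  (forall i, (i < m)%N -> facet m :&: facet i \subset facet p) ->
  separator S m \subset facet p.
Proof.
move=> sub; apply/subsetP=> x; rewrite inE => /andP[/bigcupP[i _ xi] xm].
by apply: (subsetP (sub i (ltn_ord i))); rewrite inE xm.
Qed.

Lemma card_separator m : (0 < m < size S)%N -> (#|separator S m| < #|facet m|)%N.
Proof.
move=> lt_m; have [p lt_p sub_p] := separator_parent lt_m.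
apply: proper_card; rewrite properE subsetIr /=; apply/negP=> sub.
have /andP[_ lt_mS] := lt_m.
have := facet_sub lt_mS (ltn_trans lt_p lt_mS) (subset_trans sub (separator_sub sub_p)).
by move=> eq_mp; rewrite eq_mp ltnn in lt_p.
Qed.

Lemma r_min_le m : (0 < m < size S)%N -> (r_min S <= #|separator S m|)%N.
Proof.
move=> /andP[m_gt0 lt_m]; apply/seq_min_le/map_f.
by rewrite mem_iota m_gt0 add1n prednK // (ltnW S_gt1).
Qed.

Lemma r_min_attained : exists2 m, (0 < m < size S)%N & #|separator S m| = r_min S.
Proof.
have /mapP[m] : r_min S \in [seq #|separator S m| | m <- iota 1 (size S).-1].
  by apply: seq_min_mem; case: (S) S_gt1 => // a [].
rewrite mem_iota add1n prednK ?(ltnW S_gt1) // => lt_m def_r.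
by exists m.
Qed.

Lemma r_min_lt F : F \in S -> (r_min S < #|F|)%N.
Proof.
move=> /(nthP set0)[[|i] lt_i <-]; last first.
  by apply: leq_ltn_trans (card_separator _); rewrite // r_min_le.
apply: leq_ltn_trans (r_min_le (m := 1) _) _; first by rewrite S_gt1.
rewrite /separator big_ord_recl big_ord0 setU0 /=.
apply: proper_card; rewrite properE subsetIl /=; apply/negP=> sub.
by have := facet_sub lt_i S_gt1 (subset_trans sub (subsetIr _ _)).
Qed.

Lemma n_min_le F : F \in S -> (n_min S <= #|F|)%N.
Proof. by move=> SF; apply/seq_min_le/map_f. Qed.

Lemma n_min_attained : exists2 F, F \in S & #|F| = n_min S.
Proof.
have /mapP[F SF def_n] : n_min S \in [seq #|F| | F : {set X} <- S].
  by apply: seq_min_mem; case: (S) S_gt1.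
by exists F.
Qed.

(** Cutting the tree of facets between [m] and its parent: a later facet goes to
    the side of its own parent, and what it shares with the other side lies in
    that parent, so both sides keep meeting in the separator only. *)
Lemma separator_splits m : (0 < m < size S)%N ->
  exists A B : {set X}, [/\ A :&: B = separator S m,
    forall i, (i < size S)%N -> (facet i \subset A) || (facet i \subset B),
    facet m \subset A & forall i, (i < m)%N -> facet i \subset B].
Proof.
move=> /andP[m_gt0 lt_m].
suff prefix j : (m < j <= size S)%N -> exists A B : {set X},
    [/\ A :&: B = separator S m,
        forall i, (i < j)%N -> (facet i \subset A) || (facet i \subset B),
        facet m \subset A, forall i, (i < m)%N -> facet i \subset B &
        forall x, x \in A :|: B -> exists2 i, (i < j)%N & x \in facet i].
  have [|A [B [AB cover mA mB _]]] := prefix (size S); first by rewrite lt_m leqnn.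
  by exists A, B.
elim: j => [|j IH]; first by rewrite ltn0.
rewrite ltnS => /andP[]; rewrite leq_eqVlt => /orP[/eqP <- _|lt_mj lt_j].
  exists (facet m), (\bigcup_(i < m) facet i).
  split=> //; first by rewrite setIC.
  - move=> i; rewrite ltnS leq_eqVlt => /orP[/eqP -> |lt_i]; first by rewrite subxx.
    by rewrite (bigcup_sup (Ordinal lt_i)) ?orbT.
  - by move=> i lt_i; rewrite (bigcup_sup (Ordinal lt_i)).
  - move=> x; rewrite inE => /orP[xm|/bigcupP[i _ xi]]; first by exists m.
    by exists i => //; rewrite ltnS ltnW.
have [|A [B [AB cover mA mB memAB]]] := IH; first by rewrite lt_mj ltnW.
have j_range : (0 < j < size S)%N by rewrite (leq_ltn_trans _ lt_mj).
have [p lt_p sub_p] := separator_parent j_range.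
have old_j x : x \in A :|: B -> x \in facet j -> x \in facet p.
  move=> /memAB[i lt_i xi] xj; apply: (subsetP (sub_p i lt_i)).
  by rewrite inE xj.
have mem_new C x : x \in C :|: facet j -> x \in C \/ x \in facet j.
  by rewrite inE => /orP.
have [pA|pB] := orP (cover p lt_p).
- exists (A :|: facet j), B; split=> //.
  + rewrite setIUl AB; apply/setUidPl/subsetP=> x; rewrite inE => /andP[xj xB].
    by rewrite -AB inE xB andbT (subsetP pA) // old_j // inE xB orbT.
  + move=> i; rewrite ltnS leq_eqVlt => /orP[/eqP -> |/cover /orP[iA|->]].
    * by rewrite subsetUr.
    * by rewrite (subset_trans iA (subsetUl _ _)).
    * by rewrite orbT.
  + exact: subset_trans mA (subsetUl _ _).
  + move=> x; rewrite -setUA [facet j :|: B]setUC setUA => /mem_new[/memAB[i lt_i]|xj].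
      by exists i => //; rewrite ltnS ltnW.
    by exists j.
- exists A, (B :|: facet j); split=> //.
  + rewrite setIUr AB; apply/setUidPl/subsetP=> x; rewrite inE => /andP[xA xj].
    by rewrite -AB inE xA (subsetP pB) // old_j // inE xA.
  + move=> i; rewrite ltnS leq_eqVlt => /orP[/eqP -> |/cover /orP[->//|iB]].
    * by rewrite subsetUr orbT.
    * by rewrite (subset_trans iB (subsetUl _ _)) orbT.
  + by move=> i /mB /subset_trans; apply; apply: subsetUl.
  + move=> x; rewrite setUA => /mem_new[/memAB[i lt_i]|xj].
      by exists i => //; rewrite ltnS ltnW.
    by exists j.
Qed.

(** The vertices [a] and [b] exist because neither of [facet m] and its parent contains
    the other. *)
Lemma separator_disconnects m : (0 < m < size S)%N ->
  exists (A : {set X}) (a b : X),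
    [/\ [disjoint A & separator S m],
        a \in A /\ [set a] \in Delta,
        b \notin A :|: separator S m /\ [set b] \in Delta &
        forall u v, u \notin A :|: separator S m -> v \in A -> [set u; v] \notin Delta].
Proof.
move=> m_range; have [A [B [AB cover mA mB]]] := separator_splits m_range.
have [p lt_p sub_p] := separator_parent m_range.
have /andP[_ lt_m] := m_range; have lt_pS := ltn_trans lt_p lt_m.
have sep_p := separator_sub sub_p.
have vertex x i : (i < size S)%N -> x \in facet i -> [set x] \in Delta.
  move=> lt_i xi; rewrite mem_complex; apply/(has_nthP set0); exists i => //.
  by rewrite sub1set.
have /subsetPn[a am nap] : ~~ (facet m \subset facet p).
  by apply/negP=> /(facet_sub lt_m lt_pS) eq_mp; rewrite eq_mp ltnn in lt_p.
have /subsetPn[b bp nbm] : ~~ (facet p \subset facet m).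
  by apply/negP=> /(facet_sub lt_pS lt_m) eq_mp; rewrite eq_mp ltnn in lt_p.
have QA : separator S m \subset A by rewrite -AB subsetIl.
have QE : A :\: separator S m :|: separator S m = A.
  by rewrite setUC -{1}(setIidPr QA) setID.
exists (A :\: separator S m), a, b; rewrite QE; split.
- by rewrite disjoints_subset setDE subsetIr.
- rewrite inE (subsetP mA) // andbT; split; last exact: vertex am.
  by apply: contra nap; apply: subsetP.
- split; last exact: vertex bp.
  apply: contra nbm => bA; have : b \in A :&: B by rewrite inE bA (subsetP (mB p lt_p)).
  by rewrite AB inE => /andP[].
- move=> u v nuA; rewrite inE => /andP[nvQ vA]; rewrite mem_complex.
  apply/(has_nthP set0) => -[i lt_i]; rewrite subUset !sub1set => /andP[ui vi].
  case/orP: (cover i lt_i) => [iA|iB]; first by rewrite (subsetP iA) in nuA.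
  by case/negP: nvQ; rewrite -AB inE vA (subsetP iB).
Qed.

End LeafOrder.

(** * Depth and dimensions of the skeletons *)

Section Invariants.
Variables (R : comNzRingType) (M : lmodType R).

Lemma is_depth_unique (J : {pred R}) m n : is_depth M J m -> is_depth M J n -> m = n.
Proof.
move=> [[f [fJ f_reg <-]] le_m] [[g [gJ g_reg <-]] le_n].
by apply/eqP; rewrite eqn_leq le_n ?le_m.
Qed.

Lemma is_dim_unique m n : is_dim M m -> is_dim M n -> m = n.
Proof.
move=> [[P chP] le_m] [[Q chQ] le_n].
by apply/eqP; rewrite eqn_leq (le_n _ _ chP) (le_m _ _ chQ).
Qed.

Lemma is_indim_unique m n : is_indim M m -> is_indim M n -> m = n.
Proof.
move=> [[P assP dimP] le_m] [[Q assQ dimQ] le_n].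
by apply/eqP; rewrite eqn_leq (le_m _ _ assQ dimQ) (le_n _ _ assP dimP).
Qed.

End Invariants.

Section StanleyReisnerModule.
Variables (K : fieldType) (X : finType).
Local Notation R := {mpoly K[#|X|]}.
Implicit Types (Sigma : {set {set X}}) (F G : {set X}) (f u : R) (fs : seq R).

Lemma irrelevant_idealP f :
  (f \in @irrelevant_ideal K X) <-> exists a : X -> R, f = \sum_i a i * xmon K [set i].
Proof.
split=> [/asboolP[a ->]|[a ->]]; last apply/asboolP; exists a;
  by apply: eq_bigr => i _; rewrite varXE.
Qed.

Lemma irrelevant_mcoeff0 f : (f \in @irrelevant_ideal K X) <-> f@_0%MM = 0.
Proof.
split=> [/irrelevant_idealP[a ->]|f0].
  rewrite raddf_sum big1 // => i _; rewrite /= mulrC mcoeff_xmonM msupport0.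
  by rewrite sub1set inE.
rewrite (mpolyE f) big_seq; apply: rpred_sum => m mf.
have [x xm] : exists x, x \in msupport m.
  apply/set0Pn; apply: contraTneq mf => m0.
  suff -> : m = 0%MM by rewrite mcoeff_msupp f0 eqxx.
  apply/mnmP=> i; rewrite mnm0E; apply/eqP; apply: contraT => mi.
  have : enum_val i \in msupport m by rewrite inE enum_valK.
  by rewrite m0 inE.
have le : (mset [set x] <= m)%MM by rewrite mset_le sub1set.
rewrite -(submK le) mpolyXD scalerAl; apply: ideal_genM.
apply/irrelevant_idealP; exists (fun y => (y == x)%:R).
rewrite (bigD1 x) //= eqxx mul1r big1 ?addr0 // => y /negbTE ->.
by rewrite mul0r.
Qed.

Lemma esyms_irrelevant t : {subset esyms K X t <= @irrelevant_ideal K X}.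
Proof.
move=> f /mapP[i _ ->]; apply/irrelevant_mcoeff0.
by rewrite mcoeff_mesym /mechar mdeg0.
Qed.

Section Complex.
Variables (Sigma : {set {set X}}) (simp : simplicial Sigma) (Sigma0 : set0 \in Sigma).
Local Notation M := (SR_module K Sigma).

(** The quotient by elements of the irrelevant ideal is nonzero, since all of them
    vanish at the origin; only the nonzerodivisor conditions remain. *)
Lemma SR_module_regular fs : {subset fs <= @irrelevant_ideal K X} ->
  regular_seq M fs <-> weakly_regular (SR_ideal Sigma) fs.
Proof.
move=> fsJ.
have -> : SR_ideal (K := K) Sigma = fun u => u \in ideal_gen (fun A : {set X} => A \notin Sigma)
    (fun A => \prod_(x in A) varX K x).
  by apply: ideal_ext => u; split=> /(SR_idealP u simp).
rewrite regular_seq_quot; split=> [[]//|reg]; split=> //; exists 1.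
have unit_free (I : R -> Prop) gs : (forall u, I u -> u@_0%MM = 0) ->
    {subset gs <= @irrelevant_ideal K X} -> ~ foldl (@add_ideal R) I gs 1.
  elim: gs I => [|g gs IH] I I0 gsJ /=.
    by move=> /I0/eqP; rewrite mcoeff1 eqxx oner_eq0.
  apply: IH => [u [v /I0]|h gs_h]; last by apply: gsJ; rewrite inE gs_h orbT.
  have : (g * v)@_0%MM = 0.
    by apply/irrelevant_mcoeff0; rewrite mulrC; apply: ideal_genM; apply: gsJ; apply: mem_head.
  by rewrite mcoeffB => -> /eqP; rewrite subr0 => /eqP.
by apply: unit_free => // u /(SR_idealP u simp); apply; rewrite msupport0.
Qed.

Lemma annihilator_SR_module u : (u \in annihilator M) <-> SR_ideal Sigma u.
Proof. by rewrite annihilator_quot; split=> /(SR_idealP u simp). Qed.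

Lemma is_dim_SR_module F : F \in Sigma ->
  (forall G, G \in Sigma -> #|G| <= #|F|)%N -> is_dim M #|F|.
Proof.
move=> FS le_F; apply: is_quot_dim_face => [u /annihilator_SR_module Iu|G nG].
  apply/face_primeP; apply: SR_ideal_sub Iu => G; rewrite powersetE => GF.
  exact: simp GF FS.
apply: le_F; apply: contraNT nG => GS; apply/annihilator_SR_module.
exact: SR_ideal_xmon.
Qed.

(** The prime of a facet is the annihilator of the monomial of that facet. Conversely
    the annihilator of a nonzero class [u] lies in the prime of any facet whose prime
    does not contain [u], and such a facet exists because the facet primes intersect
    in the Stanley-Reisner ideal. *)
Lemma is_indim_SR_module F : F \in facets Sigma ->
  (forall G, G \in facets Sigma -> #|F| <= #|G|)%N -> is_indim M #|F|.
Proof.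
move=> facetF min_F; split.
  move: facetF; rewrite inE => /maxsetP[FS maxF].
  have colonF : colon (SR_ideal (K := K) Sigma) (xmon K F) = SR_ideal (powerset F).
    rewrite colon_SR_ideal; congr SR_ideal; apply/setP=> G; rewrite !inE.
    apply/idP/idP => [FGS|GF]; last by rewrite (setUidPl GF).
    by rewrite -(maxF _ FGS (subsetUl _ _)) subsetUr.
  exists (face_prime F).
    apply/associated_prime_quot; split; first exact: prime_face_prime.
    exists (xmon K F) => a; rewrite mulrC.
    by apply/face_primeP/(SR_idealP _ simp) => Ia; move: Ia; rewrite -colonF.
  apply: is_quot_dim_face => // G; rewrite face_prime_xmon negbK.
  exact: subset_leq_card.
move=> P m /associated_prime_quot[[[P0 P1 _] _] [u annP]] [_ le_m].
have [G GS uG] : exists2 G, G \in facets Sigma & u \notin face_prime G.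
  apply: contrapT => nex; case/negP: P1; rewrite annP mul1r.
  apply/(SR_idealP _ simp) => m' m'S.
  have [G maxG m'G] := maxset_exists (P := fun G => G \in Sigma) m'S.
  apply: contrapT => um'; apply: nex; exists G; first by rewrite inE.
  by apply/negP=> /face_primeP /(_ m'); rewrite powersetE => /(_ m'G).
apply: leq_trans (min_F G GS) _.
have [|Q chQ] := @face_prime_chain K X G P; last exact: le_m chQ.
move=> a; rewrite annP => /(SR_idealP _ simp) Iau.
have GSigma : G \in Sigma by move: GS; rewrite inE => /maxsetp.
have : a * u \in face_prime G.
  by apply/face_primeP; apply: SR_ideal_sub Iau => H; rewrite powersetE => /simp; apply.
have [_ primeG] := prime_face_prime K G.
by move/primeG; rewrite (negbTE uG) orbF.
Qed.

End Complex.
End StanleyReisnerModule.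

Section Skeletons.
Variables (K : fieldType) (X : finType) (Delta : {set {set X}}) (S : seq {set X}).
Hypotheses (simp : simplicial Delta) (leafS : leaf_order Delta S) (S_gt1 : (1 < size S)%N).
Variables (kap : nat) (kap_le : (kap <= \max_(F in Delta) #|F|)%N).
Implicit Types F G : {set X}.

Local Notation Sigma := (generated_skeleton kap S).
Local Notation M := (SR_module K Sigma).
Local Notation simpS := (@simplicial_generated_skeleton X kap S).

Lemma mem_skeleton F : (F \in Sigma) = (#|F| <= kap)%N && (F \in Delta).
Proof. by rewrite inE (mem_complex simp leafS). Qed.

Lemma subset_of_card F k : (k <= #|F|)%N ->
  exists2 G : {set X}, G \subset F & #|G| = k.
Proof.
move=> le_k; exists [set x in take k (enum F)].
  by apply/subsetP=> x; rewrite inE => /mem_take; rewrite mem_enum.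
rewrite cardsE (card_uniqP _) ?take_uniq ?enum_uniq //.
by rewrite size_takel // -cardE.
Qed.

Lemma facet_in_complex F : F \in S -> F \in Delta.
Proof. by rewrite (facet_in leafS) => /maxsetp. Qed.

Lemma set0_in_skeleton : set0 \in Sigma.
Proof.
have [F SF _] := n_min_attained S_gt1.
by rewrite mem_skeleton cards0 (simp (sub0set F)) // facet_in_complex.
Qed.

Lemma is_dim_skeleton : is_dim M kap.
Proof.
have Delta_gt0 : (0 < #|Delta|)%N.
  apply/card_gt0P; have [F SF _] := n_min_attained S_gt1.
  by exists F; apply: facet_in_complex.
have [F0 F0D max_F0] := eq_bigmax_cond (fun F : {set X} => #|F|) Delta_gt0.
have [F FF0 card_F] : exists2 F : {set X}, F \subset F0 & #|F| = kap.
  by apply: subset_of_card; rewrite -max_F0.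
rewrite -{2}card_F; apply: is_dim_SR_module; first exact: simpS.
  by rewrite mem_skeleton card_F leqnn (simp FF0).
by move=> G; rewrite mem_skeleton card_F => /andP[].
Qed.

(** A facet of the skeleton with fewer than [kap] elements cannot be enlarged in the
    full complex, hence is one of its facets. *)
Lemma facet_skeleton_large F : F \in facets Sigma -> (minn kap (n_min S) <= #|F|)%N.
Proof.
rewrite inE => /maxsetP[]; rewrite mem_skeleton (mem_complex simp leafS).
move=> /andP[le_F /hasP[G SG FG]] maxF; rewrite geq_min.
have [GF|/subsetPn[x xG xF]] := boolP (G \subset F).
  by rewrite (leq_trans (n_min_le SG)) ?orbT // subset_leq_card.
rewrite leqNgt; case: ltnP => // lt_F; case/negP: xF.
suff <- : x |: F = F by rewrite setU11.
apply: maxF; rewrite ?subsetUr // mem_skeleton (mem_complex simp leafS).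
apply/andP; split; last by apply/hasP; exists G; rewrite // subUset sub1set xG.
by rewrite cardsU1; case: (_ \notin _) => //; apply: ltnW.
Qed.

Lemma is_indim_skeleton : is_indim M (minn kap (n_min S)).
Proof.
have [F0 SF0 card_F0] := n_min_attained S_gt1.
have F0D := facet_in_complex SF0.
(* A smallest facet of the full complex, cut down to [kap] elements if necessary. *)
have [F facetF card_F] : exists2 F, F \in facets Sigma & #|F| = minn kap (n_min S).
  have [lt_n|le_n] := ltnP kap (n_min S); last first.
    exists F0 => //; rewrite inE; apply/maxsetP; rewrite mem_skeleton card_F0 le_n.
    split=> // G; rewrite mem_skeleton => /andP[_ GD] F0G.
    by move: SF0; rewrite (facet_in leafS) => /maxsetP[_]; apply.
  have [F FF0 card_F] : exists2 F : {set X}, F \subset F0 & #|F| = kap.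
    by apply: subset_of_card; rewrite card_F0 ltnW.
  exists F => //; rewrite inE; apply/maxsetP; rewrite mem_skeleton card_F leqnn.
  rewrite (simp FF0) //; split=> // G; rewrite mem_skeleton => /andP[le_G _] FG.
  by apply/esym/eqP; rewrite eqEcard FG card_F.
rewrite -card_F; apply: is_indim_SR_module => //; first exact: simpS.
by move=> G /facet_skeleton_large; rewrite card_F.
Qed.

Lemma is_depth_skeleton : is_depth M (@irrelevant_ideal K X) (minn kap (r_min S).+1).
Proof.
have regularE := SR_module_regular (K := K) simpS set0_in_skeleton.
split=> [|fs fsJ].
  exists (esyms K X (minn kap (r_min S).+1)); split.
  - exact: esyms_irrelevant.
  - apply/regularE; first exact: esyms_irrelevant.
    apply: weakly_regular_leaf_order.
    + exact: ltnW.
    + exact: geq_minl.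
    + apply: leq_trans (geq_minr _ _) _.
      by apply: (r_min_lt leafS S_gt1); rewrite mem_nth // ltnW.
    + move=> m m_range; apply: leq_trans (geq_minr _ _) _.
      by rewrite ltnS (r_min_le S_gt1).
    + move=> m m_range; have [p lt_p sub_p] := separator_parent leafS m_range.
      by exists p => //; apply: separator_sub.
  - by rewrite size_map size_iota.
move=> /regularE -/(_ fsJ) reg.
have fs_lin f : f \in fs -> exists a : X -> {mpoly K[#|X|]}, f = \sum_i a i * xmon K [set i].
  by move=> /fsJ /irrelevant_idealP.
have [le_r|lt_r] := leqP kap (r_min S).
  rewrite (minn_idPl (leqW le_r)).
  have [F0 SF0 _] := n_min_attained S_gt1.
  have [C CF0 card_C] : exists2 C : {set X}, C \subset F0 & #|C| = kap.+1.
    by apply: subset_of_card; apply: leq_ltn_trans le_r (r_min_lt leafS S_gt1 SF0).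
  apply: (regular_length_missing_face (C := C) simpS) reg => //.
    by move=> F; rewrite mem_skeleton => /andP[].
  move=> i iC; rewrite mem_skeleton; move: card_C; rewrite (cardsD1 i) iC add1n => -[->].
  by rewrite leqnn (simp (subset_trans (subD1set _ _) CF0)) // facet_in_complex.
rewrite (minn_idPr lt_r).
have [m m_range card_Q] := r_min_attained S_gt1.
have [A [a [b [dAQ [aA aD] [bA bD] sep]]]] := separator_disconnects simp leafS m_range.
have kap_gt0 : (0 < kap)%N := leq_ltn_trans (leq0n _) lt_r.
rewrite -card_Q; apply: (regular_length_separator simpS dAQ aA _ bA) reg => //.
- by rewrite mem_skeleton cards1 kap_gt0.
- by rewrite mem_skeleton cards1 kap_gt0.
- by move=> u v nu vA; rewrite mem_skeleton negb_and sep // orbT.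
Qed.

End Skeletons.

Lemma simplicial_clique_complex (X : finType) (e : rel X) : simplicial (clique_complex e).
Proof.
move=> A B /subsetP AB; rewrite !inE => /forall_inP cB.
apply/forall_inP=> x /AB/cB /forall_inP cBx.
by apply/forall_inP=> y /AB/cBx.
Qed.

Lemma skeletonE (X : finType) (Delta : {set {set X}}) S (k : int) (kap : nat) :
  simplicial Delta -> leaf_order Delta S -> k = kap%:Z - 1 ->
  skeleton k Delta = generated_skeleton kap S.
Proof.
move=> simp leafS ->; apply/setP=> F; rewrite !inE (mem_complex simp leafS) andbC.
by congr (_ && _); rewrite /face_dim Num.Theory.lerD2r lez_nat.
Qed.

Theorem corollary3 (K : fieldType) (X : finType) (e : rel X)
    (e_sym : symmetric e) (e_irr : irreflexive e) (e_chordal : chordal e)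
    (two_facets : (2 <= #|facets (clique_complex e)|)%N)
    (S : seq {set X}) (S_leaf : leaf_order (clique_complex e) S) :
  let Delta := clique_complex e in
  let rmin : int := (r_min S)%:Z in
  let nmin : int := (n_min S)%:Z in
  let in_range (k : int) := -1 <= k <= complex_dim Delta in
  let iCM (k : int) :=
    initially_Cohen_Macaulay (SR_module K (skeleton k Delta)) in
  let CM (k : int) := Cohen_Macaulay (SR_module K (skeleton k Delta)) in
  [/\ forall k : int, in_range k ->
        (iCM k <-> k <= rmin \/ rmin = nmin - 1),
      rmin < nmin - 1 -> forall k : int, in_range k -> (iCM k <-> k <= rmin),
      rmin = nmin - 1 -> forall k : int, in_range k -> iCM k &
      forall k : int, in_range k -> (CM k <-> k <= rmin)].
Proof.
move=> Delta rmin nmin in_range iCM CM.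
have simp : simplicial Delta := @simplicial_clique_complex X e.
have S_gt1 : (1 < size S)%N.
  have [uniqS memS _] := S_leaf.
  by rewrite -(card_uniqP uniqS) (eq_card memS).
have lt_rn : (r_min S < n_min S)%N.
  have [F SF <-] := n_min_attained S_gt1; exact: (r_min_lt S_leaf).
have invariants k : in_range k -> exists kap : nat,
    [/\ k = kap%:Z - 1,
        iCM k <-> minn kap (r_min S).+1 = minn kap (n_min S) &
        CM k <-> minn kap (r_min S).+1 = kap].
  move=> /andP[ge_k le_k].
  have [kap def_k] : exists kap : nat, k = kap%:Z - 1 by exists (absz (k + 1)); lia.
  exists kap.
  have kap_le : (kap <= \max_(F in Delta) #|F|)%N.
    by move: le_k; rewrite def_k Num.Theory.lerD2r lez_nat.
  have depth := is_depth_skeleton K simp S_leaf S_gt1 kap.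
  have dim := is_dim_skeleton K simp S_leaf S_gt1 kap_le.
  have indim := is_indim_skeleton K simp S_leaf S_gt1 kap.
  rewrite /iCM /CM (skeletonE simp S_leaf def_k); split=> //; split.
  - by case=> n [/(is_depth_unique depth) -> /(is_indim_unique indim)].
  - by move=> eq_t; exists (minn kap (n_min S)); split=> //; rewrite -eq_t.
  - by case=> n [/(is_depth_unique depth) -> /(is_dim_unique dim)].
  - by move=> eq_t; exists kap; split=> //; rewrite -{2}eq_t.
have iCM_iff k : in_range k -> (iCM k <-> k <= rmin \/ rmin = nmin - 1).
  by move=> /invariants[kap [-> -> _]]; rewrite /rmin /nmin; split; lia.
split=> // [lt_r k range_k|eq_r k range_k|k range_k].
- by rewrite iCM_iff //; split; [case=> // eq_r; lia|left].
- by rewrite iCM_iff //; right.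
- by have [kap [-> _ ->]] := invariants k range_k; rewrite /rmin; split; lia.
Qed.
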